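(* Let $A=k\mathcal{Q}$ be the algebra of a quiver with relations and sections with $n$ vertices, and let $B=\mathrm{Br}_{(a_k,\dots,a_2,a_1)}(A)$ be obtained from $A$ by breaking at the sequence $(a_k,\dots,a_2,a_1)$. Then: (1) $B$ is Morita equivalent to $A$. (2) The inverse right adjoint to the functor $\mathrm{Br}_{(a_k,\dots,a_2,a_1)}:\mathrm{Mod}(A)\to\mathrm{Mod}(B)$ is the functor $\mathrm{Hom}_B(P,-)$, where $P$ is the projective $B$-module $$P=\bigoplus_{u,v}M_{uv}P_v,\qquad M=E_1E_2\cdots E_k,$$ and $E_i$ is the elementary matrix obtained from the $n\times n$ identity matrix (indexed by the vertices) by adding $1$ in the $(ta_i,ha_i)$-entry. (3) Moreover, for any $A$-module $M$, on each vertex $v$ the module $\mathrm{Br}_{(a_k,\dots,a_2,a_1)}(M)$ is $$\mathrm{Coker}\Big(\sum_{ta_i=v}a_i^r\Big)=\bigcap_{ta_i=v}\mathrm{Ker}(a_i).$$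
   Context: $k$ is a fixed PID (the letter $k$ is also used for the length of the sequence of breakings). $\mathrm{Mod}(A)$ is the category of finitely generated left $A$-modules. Paths in a quiver $Q$ compose right to left: an arrow $a$ goes from its tail $ta$ to its head $ha$, and $a\in e_{ha}(kQ)e_{ta}$, where $e_v$ is the trivial path (vertex idempotent) at $v$. For an $A$-module $M$, its part on the vertex $v$ is $M(v)=e_vM$. The algebra $k\mathcal{Q}$ is the path algebra $kQ$ of a finite quiver $Q$ modulo the ideal generated by a set $R$ of relations ($k$-linear combinations of paths with common tail and common head). Sections. If two non-loop arrows $a,a^r$ satisfy $aa^r=e_{ha}$, then $a^r$ is called a section of $a$, and $a$ a projection. More generally, for an algebra with fixed vertex idempotents, the same definition is used for elements: $a^r\in e_uAe_v$ is a section of $a\in e_vAe_u$ (with $u\neq v$, $ta=u$, $ha=v$) if $aa^r=e_v$. A quiver with relations and sections (QRS) is $\mathcal{Q}=(Q,R,S)$ with $S$ the set of all arrows that are sections; it is required that no arrow is both a section and a projection, and that $k\mathcal{Q}$ becomes finite-dimensional after base change to any field. The vertex idempotents are assumed to give a basic partition: there is a complete set $\{e_{ij}\}$ of primitive orthogonal idempotents of $A$ with vertex idempotents $e_i=\sum_j e_{ij}$, such that, with $b=\sum_i e_{i1}$, the algebra $bAb$ is the basic algebra associated to $A$. Breaking. For $a\in A$ with section $a^r$, let $e$ be the unit of $A$ and $e'=e-a^ra$. Put $\mathrm{Br}_a(A)=e'Ae'$, $\mathrm{Br}_a(c)=e'ce'$ for $c\in A$, and also write $\mathrm{Br}_a$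 for the functor $e'(-):\mathrm{Mod}(A)\to\mathrm{Mod}(\mathrm{Br}_a(A))$. The algebra $\mathrm{Br}_a(A)$ inherits vertex idempotents from $A$, indexed by the same vertices: $e_{ta}$ is replaced by $e_{ta}-a^ra$ and all others are kept. Breaking at a sequence. For elements $a_1,\dots,a_k$ with chosen $a_1^r,\dots,a_k^r$, one defines recursively $\mathrm{Br}_{(a_{i+1},a_i,\dots,a_1)}=\mathrm{Br}_{\mathrm{Br}_{(a_i,\dots,a_1)}(a_{i+1})}\circ\mathrm{Br}_{(a_i,\dots,a_1)}$, starting from $\mathrm{Br}_{a_1}$. It is part of the definition that $\mathrm{Br}_{(a_i,\dots,a_1)}(a_{i+1}^r)$ is a section of $\mathrm{Br}_{(a_i,\dots,a_1)}(a_{i+1})$ in $\mathrm{Br}_{(a_i,\dots,a_1)}(A)$ for each $i$. In (2), $P_v$ is the projective $B$-module $Be^B_v$ at the vertex $v$, where $e^B_v$ is the inherited vertex idempotent of $B$, and $M_{uv}P_v$ is the direct sum of $M_{uv}$ copies of $P_v$. In (3), $a_i:M(v)\to M(ha_i)$ and $a_i^r:M(ha_i)\to M(v)$ are the actions of $a_i,a_i^r$ on $M$, the sum is the map $\bigoplus_{ta_i=v}M(ha_i)\to M(v)$, and the equality of cokernel and kernel is an identification as $k$-modules.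
   Formalization: Part (3) fails for the original a_i in general; it is proved with a_i, a_i^r replaced by their images under Br_(a_{i-1},...,a_1), and with the original a_i, a_i^r only at vertices v where no a_i with ta_i=v has ha_i equal to the tail of an earlier a_j. *)

(* Defs.v *)
From HB Require Import structures.
From mathcomp Require Import all_boot all_algebra.
From mathcomp Require Import boolp finmap monalg.

Set Implicit Arguments.
Unset Strict Implicit.
Unset Printing Implicit Defensive.

Import GRing.Theory.
Local Open Scope ring_scope.
Local Open Scope quotient_scope.

Definition is_PID (k : idomainType) : Prop :=
  forall J : k -> Prop,
    J 0 -> (forall x y, J x -> J y -> J (x + y)) ->
    (forall c x, J x -> J (c * x)) ->
    exists d, forall x, J x <-> exists c, x = c * d.

(* A k-algebra is a ring with a ring morphism from k to its centre. MathComp's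
   algType is not used because it excludes the zero ring, which is the path
   algebra of the empty quiver and which a corner ring eAe may be. *)
Record kalg (k : comNzRingType) := KAlg {
  kalg_ring :> pzRingType;
  scal : {rmorphism k -> kalg_ring};
  scalC : forall c x, scal c * x = x * scal c
}.
Arguments scal {k} A : rename.

Section Generated.
Variable A : pzRingType.

Definition ideal2 (J : A -> Prop) : Prop :=
  [/\ J 0, forall x y, J x -> J y -> J (x + y)
    & forall a b x, J x -> J (a * x * b)].

Definition gen_ideal (R : A -> Prop) (x : A) : Prop :=
  forall J, ideal2 J -> (forall r, R r -> J r) -> J x.

Lemma gen_idealP R : ideal2 (gen_ideal R).
Proof.
split=> [J []//|x y Ix Iy J idJ RJ|a b x Ix J idJ RJ].
  by have [_ D _] := idJ; apply: D; [apply: Ix|apply: Iy].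
by have [_ _ M] := idJ; apply: M; apply: Ix.
Qed.

Definition ideal_pred (R : A -> Prop) : {pred A} := fun x => `[< gen_ideal R x >].

Lemma ideal_pred_zmod R : zmod_closed (ideal_pred R).
Proof.
have [I0 ID IM] := gen_idealP R.
split=> [|x y /asboolP Ix /asboolP Iy]; apply/asboolP => //.
by apply: ID => //; rewrite -mulN1r -[_ * y]mulr1; apply: IM.
Qed.
HB.instance Definition _ R :=
  GRing.isZmodClosed.Build A (ideal_pred R) (ideal_pred_zmod R).

Lemma ideal_predM R a b x : x \in ideal_pred R -> a * x * b \in ideal_pred R.
Proof. by move=> /asboolP Ix; apply/asboolP; case: (gen_idealP R) => _ _; apply. Qed.

End Generated.

(* The quotient of A by the two-sided ideal generated by R. *)
Section Quotient.
Variables (A : pzRingType) (R : A -> Prop).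

Definition ring_quot := @Quotient.quot A (ideal_pred R : zmodClosed A).
HB.instance Definition _ := GRing.Zmodule.on ring_quot.
HB.instance Definition _ := ZmodQuotient.on ring_quot.

Definition quot_pi (x : A) : ring_quot := \pi_ring_quot x.

Lemma quot_eqP (x y : A) :
  reflect (quot_pi x = quot_pi y) (x - y \in ideal_pred R).
Proof. by rewrite Quotient.idealrBE; apply: eqP. Qed.
Lemma quot_pi_surj (y : ring_quot) : exists x, quot_pi x = y.
Proof. by exists (repr y); rewrite /quot_pi reprK. Qed.
Lemma quot_pi_additive : zmod_morphism quot_pi.
Proof. by move=> x y; rewrite /quot_pi raddfB. Qed.
HB.instance Definition _ :=
  GRing.isZmodMorphism.Build A ring_quot quot_pi quot_pi_additive.

Definition quot_one : ring_quot := quot_pi 1.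
Definition quot_mul (x y : ring_quot) : ring_quot := quot_pi (repr x * repr y).

Lemma quot_pi_mul x y : quot_pi (x * y) = quot_mul (quot_pi x) (quot_pi y).
Proof.
apply/quot_eqP.
set x' := repr _; set y' := repr _.
have Hx : x - x' \in ideal_pred R by apply/quot_eqP; rewrite /x' /quot_pi reprK.
have Hy : y - y' \in ideal_pred R by apply/quot_eqP; rewrite /y' /quot_pi reprK.
rewrite -[x * y](subrK (x' * y)) -mulrBl -addrA -mulrBr rpredD //.
  by rewrite -[_ * y]mul1r mulrA; apply: ideal_predM.
by rewrite -[_ * _]mulr1; apply: ideal_predM.
Qed.

Lemma quot_mulA : associative quot_mul.
Proof.
move=> x y z; have [[x' <-] [[y' <-] [z' <-]]] :=
  (quot_pi_surj x, (quot_pi_surj y, quot_pi_surj z)).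
by rewrite -!quot_pi_mul mulrA.
Qed.
Lemma quot_mul1l : left_id quot_one quot_mul.
Proof. by move=> x; have [y <-] := quot_pi_surj x; rewrite -quot_pi_mul mul1r. Qed.
Lemma quot_mul1r : right_id quot_one quot_mul.
Proof. by move=> x; have [y <-] := quot_pi_surj x; rewrite -quot_pi_mul mulr1. Qed.
Lemma quot_mulDl : left_distributive quot_mul +%R.
Proof.
move=> x y z; have [[x' <-] [[y' <-] [z' <-]]] :=
  (quot_pi_surj x, (quot_pi_surj y, quot_pi_surj z)).
by rewrite -raddfD -!quot_pi_mul -raddfD mulrDl.
Qed.
Lemma quot_mulDr : right_distributive quot_mul +%R.
Proof.
move=> x y z; have [[x' <-] [[y' <-] [z' <-]]] :=
  (quot_pi_surj x, (quot_pi_surj y, quot_pi_surj z)).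
by rewrite -raddfD -!quot_pi_mul -raddfD mulrDr.
Qed.
HB.instance Definition _ := GRing.Zmodule_isPzRing.Build ring_quot
  quot_mulA quot_mul1l quot_mul1r quot_mulDl quot_mulDr.

Lemma quot_pi_multiplicative : monoid_morphism quot_pi.
Proof. by split=> // x y; rewrite quot_pi_mul. Qed.
HB.instance Definition _ :=
  GRing.isMonoidMorphism.Build A ring_quot quot_pi quot_pi_multiplicative.

Lemma quot_piP (x : A) : quot_pi x = 0 <-> gen_ideal R x.
Proof.
rewrite -(raddf0 quot_pi); split=> [/quot_eqP|Rx]; last first.
  by apply/quot_eqP; rewrite subr0; apply/asboolP.
by rewrite subr0 => /asboolP.
Qed.

End Quotient.

Section KQuotient.
Variables (k : comNzRingType) (A : kalg k) (R : A -> Prop).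
Definition kquot_scal : k -> ring_quot R := quot_pi R \o scal A.
HB.instance Definition _ := GRing.RMorphism.on kquot_scal.
Lemma kquot_scalC c x : kquot_scal c * x = x * kquot_scal c.
Proof.
by have [y <-] := quot_pi_surj x; rewrite /kquot_scal /= -!rmorphM scalC.
Qed.
Definition kquot : kalg k := KAlg kquot_scalC.
End KQuotient.

Record quiver (n : nat) := Quiver {
  arrow :> finType;
  tl : arrow -> 'I_n;
  hd : arrow -> 'I_n
}.
Arguments tl {n q}.
Arguments hd {n q}.

(* A path from u to v is stored as its head v and the word [:: a_l; ...; a_1]
   with tl a_1 = u, hd a_i = tl a_(i+1) and hd a_l = v: the word is in the
   right-to-left order of composition. The trivial path at v is (v, [::]). *)
Section PathAlgebra.
Variables (k : comNzRingType) (n : nat) (Q : quiver n).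

Fixpoint is_path (v : 'I_n) (w : seq Q) : bool :=
  if w is a :: w' then (hd a == v) && is_path (tl a) w' else true.

Record qpath := QPath {
  qpath_val : 'I_n * seq Q;
  _ : is_path qpath_val.1 qpath_val.2
}.
HB.instance Definition _ := [isSub for qpath_val].
HB.instance Definition _ := [Choice of qpath by <:].

Definition path_word (p : qpath) : seq Q := (val p).2.
Definition path_head (p : qpath) : 'I_n := (val p).1.
Definition path_tail (p : qpath) : 'I_n :=
  last (path_head p) [seq tl a | a <- path_word p].

Lemma is_path_cat v w w' :
  is_path v (w ++ w') = is_path v w && is_path (last v [seq tl a | a <- w]) w'.
Proof. by elim: w v => //= a w IH v; rewrite IH andbA. Qed.

Definition path_triv (v : 'I_n) : qpath := @QPath (v, [::]) isT.

Lemma path_arrow_subproof (a : Q) : is_path (hd a) [:: a].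
Proof. by rewrite /= eqxx. Qed.
Definition path_arrow (a : Q) : qpath := @QPath (hd a, [:: a]) (path_arrow_subproof a).

(* p q means q first, then p; it is defined when tail p = head q. *)
Definition path_comp (p q : qpath) : option qpath :=
  if path_tail p == path_head q
  then insub (path_head p, path_word p ++ path_word q) else None.

Lemma path_comp_some p q : path_tail p = path_head q ->
  exists2 r, path_comp p q = Some r &
    val r = (path_head p, path_word p ++ path_word q).
Proof.
move=> H; rewrite /path_comp H eqxx; case: insubP => [r _ rE|]; first by exists r.
move: H; rewrite /path_tail /path_head /path_word => /= H.
by rewrite is_path_cat H (valP p) (valP q).
Qed.
Lemma path_comp_none p q : path_tail p <> path_head q -> path_comp p q = None.
Proof. by move=> /eqP/negPf H; rewrite /path_comp H. Qed.

Definition path_alg := {malg k[qpath]}.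
HB.instance Definition _ := GRing.Lmodule.on path_alg.

Definition path_elt (p : qpath) : path_alg := << p >>.
Definition path_mulb (p q : qpath) : path_alg := oapp path_elt 0 (path_comp p q).
Definition path_one : path_alg := \sum_(v < n) path_elt (path_triv v).
Definition path_mul (x y : path_alg) : path_alg :=
  \sum_(p <- msupp x) \sum_(q <- msupp y) (x@_p * y@_q) *: path_mulb p q.

Lemma path_algE (x : path_alg) : x = \sum_(p <- msupp x) x@_p *: path_elt p.
Proof.
rewrite {1}(monalgE x); apply: eq_bigr => p _; apply/malgP => q.
by rewrite mcoeffZ !mcoeffU mulr_natr.
Qed.

Lemma path_mulEw (x y : path_alg) (X Y : {fset qpath}) :
  (msupp x `<=` X)%fset -> (msupp y `<=` Y)%fset ->
  path_mul x y =
  \sum_(p <- X) \sum_(q <- Y) (x@_p * y@_q) *: path_mulb p q.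
Proof.
move=> sX sY; rewrite /path_mul (big_fset_incl _ sX) /=; last first.
  by move=> p _ /mcoeff_outdom ->; rewrite big1 // => q _; rewrite mul0r scale0r.
apply: eq_bigr => p _; rewrite (big_fset_incl _ sY) //=.
by move=> q _ /mcoeff_outdom ->; rewrite mulr0 scale0r.
Qed.

Lemma path_mulDl : left_distributive path_mul +%R.
Proof.
move=> x y z.
set X := (msupp x `|` msupp y `|` msupp (x + y))%fset.
have sx : (msupp x `<=` X)%fset by rewrite /X -fsetUA fsubsetUl.
have sy : (msupp y `<=` X)%fset by rewrite /X [(_ `|` msupp y)%fset]fsetUC -fsetUA fsubsetUl.
have sxy : (msupp (x + y) `<=` X)%fset by rewrite /X fsubsetUr.
rewrite (path_mulEw sxy (fsubset_refl _)) (path_mulEw sx (fsubset_refl _)).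
rewrite (path_mulEw sy (fsubset_refl _)) -big_split; apply: eq_bigr => p _ /=.
by rewrite -big_split; apply: eq_bigr => q _; rewrite mcoeffD mulrDl scalerDl.
Qed.

Lemma path_mulDr : right_distributive path_mul +%R.
Proof.
move=> z x y.
set X := (msupp x `|` msupp y `|` msupp (x + y))%fset.
have sx : (msupp x `<=` X)%fset by rewrite /X -fsetUA fsubsetUl.
have sy : (msupp y `<=` X)%fset by rewrite /X [(_ `|` msupp y)%fset]fsetUC -fsetUA fsubsetUl.
have sxy : (msupp (x + y) `<=` X)%fset by rewrite /X fsubsetUr.
rewrite (path_mulEw (fsubset_refl _) sxy) (path_mulEw (fsubset_refl _) sx).
rewrite (path_mulEw (fsubset_refl _) sy) -big_split; apply: eq_bigr => p _ /=.
by rewrite -big_split; apply: eq_bigr => q _; rewrite mcoeffD mulrDr scalerDl.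
Qed.

Lemma path_mulZl c x y : path_mul (c *: x) y = c *: path_mul x y.
Proof.
rewrite (path_mulEw (msuppZ_le c x) (fsubset_refl _)) /path_mul scaler_sumr.
apply: eq_bigr => p _; rewrite scaler_sumr; apply: eq_bigr => q _.
by rewrite mcoeffZ scalerA mulrA.
Qed.
Lemma path_mulZr c x y : path_mul x (c *: y) = c *: path_mul x y.
Proof.
rewrite (path_mulEw (fsubset_refl _) (msuppZ_le c y)) /path_mul scaler_sumr.
apply: eq_bigr => p _; rewrite scaler_sumr; apply: eq_bigr => q _.
by rewrite mcoeffZ scalerA mulrCA.
Qed.

Lemma path_mul0l x : path_mul 0 x = 0.
Proof. by rewrite -[in LHS](scale0r (0 : path_alg)) path_mulZl scale0r. Qed.
Lemma path_mul0r x : path_mul x 0 = 0.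
Proof. by rewrite -[in LHS](scale0r (0 : path_alg)) path_mulZr scale0r. Qed.

Lemma path_mul_suml I (r : seq I) (F : I -> path_alg) y :
  path_mul (\sum_(i <- r) F i) y = \sum_(i <- r) path_mul (F i) y.
Proof.
by elim: r => [|i r IH]; rewrite ?(big_nil, big_cons) ?path_mul0l // path_mulDl IH.
Qed.
Lemma path_mul_sumr I (r : seq I) (F : I -> path_alg) x :
  path_mul x (\sum_(i <- r) F i) = \sum_(i <- r) path_mul x (F i).
Proof.
by elim: r => [|i r IH]; rewrite ?(big_nil, big_cons) ?path_mul0r // path_mulDr IH.
Qed.

Lemma path_mul_elt p q : path_mul (path_elt p) (path_elt q) = path_mulb p q.
Proof.
rewrite (path_mulEw msuppU_le msuppU_le) !big_seq_fset1.
by rewrite !mcoeffUU mulr1 scale1r.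
Qed.

Lemma path_mulbA p q r :
  path_mul (path_mulb p q) (path_elt r) = path_mul (path_elt p) (path_mulb q r).
Proof.
rewrite /path_mulb.
have [Epq|Npq] := eqVneq (path_tail p) (path_head q); last first.
  rewrite path_comp_none /=; last exact/eqP.
  have [Eqr|Nqr] := eqVneq (path_tail q) (path_head r); last first.
    by rewrite path_comp_none /= ?path_mul0l ?path_mul0r //; apply/eqP.
  have [s -> sE] := path_comp_some Eqr; rewrite /= path_mul0l path_mul_elt.
  rewrite /path_mulb path_comp_none //; apply/eqP.
  by rewrite /path_head sE.
have [s -> sE] := path_comp_some Epq.
have ts : path_tail s = path_tail q.
  by move: Epq; rewrite /path_tail /path_head /path_word sE /= map_cat last_cat => ->.
have [Eqr|Nqr] := eqVneq (path_tail q) (path_head r); last first.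
  rewrite /= path_mul_elt /path_mulb !path_comp_none ?ts /= ?path_mul0r //; exact/eqP.
have [t -> tE] := path_comp_some Eqr; rewrite /= !path_mul_elt /path_mulb.
have [u -> uE] := path_comp_some (etrans ts Eqr).
have Ept : path_tail p = path_head t by rewrite /path_head tE.
have [v -> vE] := path_comp_some Ept; congr (path_elt _); apply: val_inj.
by rewrite uE vE /path_head /path_word sE tE /= catA.
Qed.

Lemma path_alg_ind (P : path_alg -> Prop) :
  P 0 -> (forall c p x, P x -> P (c *: path_elt p + x)) -> forall x, P x.
Proof.
move=> P0 PS x; rewrite (path_algE x).
by elim: {1}(msupp x : seq _) => [|p r IH]; rewrite ?big_nil ?big_cons //; apply: PS.
Qed.

Lemma path_mulPl c u x y :
  path_mul (c *: u + x) y = c *: path_mul u y + path_mul x y.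
Proof. by rewrite path_mulDl path_mulZl. Qed.
Lemma path_mulPr c u x y :
  path_mul y (c *: u + x) = c *: path_mul y u + path_mul y x.
Proof. by rewrite path_mulDr path_mulZr. Qed.

Lemma path_mulA_elt2 p q z :
  path_mul (path_elt p) (path_mul (path_elt q) z) =
  path_mul (path_mul (path_elt p) (path_elt q)) z.
Proof.
elim/path_alg_ind: z => [|c r z IH]; first by rewrite !path_mul0r.
rewrite (path_mulPr c _ z (path_elt q)) (path_mulPr c) (path_mulPr c) IH.
by rewrite !path_mul_elt path_mulbA.
Qed.
Lemma path_mulA_elt1 p y z :
  path_mul (path_elt p) (path_mul y z) = path_mul (path_mul (path_elt p) y) z.
Proof.
elim/path_alg_ind: y => [|c q y IH].
  by rewrite path_mul0l path_mul0r path_mul0l.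
rewrite (path_mulPl c _ y z) (path_mulPr c _ y) (path_mulPr c) (path_mulPl c) IH.
by rewrite path_mulA_elt2.
Qed.
Lemma path_mulA : associative path_mul.
Proof.
move=> x y z; elim/path_alg_ind: x => [|c p x IH]; first by rewrite !path_mul0l.
rewrite path_mulPl (path_mulPl c _ x y) (path_mulPl c _ _ z) IH.
by rewrite path_mulA_elt1.
Qed.

Lemma path_mul1l : left_id path_one path_mul.
Proof.
move=> x; rewrite (path_algE x) path_mul_sumr; apply: eq_bigr => p _.
rewrite path_mulZr; congr (_ *: _); rewrite /path_one path_mul_suml.
rewrite (bigD1 (path_head p)) //= big1 ?addr0 => [|v vp].
  rewrite path_mul_elt /path_mulb.
  have [|s -> sE] := @path_comp_some (path_triv (path_head p)) p; first by [].
  by congr (path_elt _); apply: val_inj; rewrite sE /path_head /path_word /=; case: (val p).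
by rewrite path_mul_elt /path_mulb path_comp_none //; apply/eqP.
Qed.

Lemma path_mul1r : right_id path_one path_mul.
Proof.
move=> x; rewrite (path_algE x) path_mul_suml; apply: eq_bigr => p _.
rewrite path_mulZl; congr (_ *: _); rewrite /path_one path_mul_sumr.
rewrite (bigD1 (path_tail p)) //= big1 ?addr0 => [|v vp].
  rewrite path_mul_elt /path_mulb.
  have [|s -> sE] := @path_comp_some p (path_triv (path_tail p)); first by [].
  by congr (path_elt _); apply: val_inj; rewrite sE /path_head /path_word /= cats0; case: (val p).
by rewrite path_mul_elt /path_mulb path_comp_none //; apply/nesym/eqP.
Qed.

HB.instance Definition _ := GRing.Zmodule_isPzRing.Build path_alg
  path_mulA path_mul1l path_mul1r path_mulDl path_mulDr.

Definition path_scal (c : k) : path_alg := c *: path_one.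
Lemma path_scal_additive : zmod_morphism path_scal.
Proof. by move=> c d; rewrite /path_scal scalerBl. Qed.
Lemma path_scal_multiplicative : monoid_morphism path_scal.
Proof.
split=> [|c d]; first by rewrite /path_scal scale1r.
by rewrite /path_scal [RHS]path_mulZl path_mul1l scalerA.
Qed.
HB.instance Definition _ :=
  GRing.isZmodMorphism.Build k path_alg path_scal path_scal_additive.
HB.instance Definition _ :=
  GRing.isMonoidMorphism.Build k path_alg path_scal path_scal_multiplicative.
Lemma path_scalC c (x : path_alg) : path_scal c * x = x * path_scal c.
Proof. by rewrite [LHS]path_mulZl [RHS]path_mulZr path_mul1l path_mul1r. Qed.
Definition path_kalg : kalg k := KAlg path_scalC.

End PathAlgebra.

Definition fin_gen (A : pzRingType) (M : lmodType A) : Prop :=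
  exists s : seq M, forall m, exists c : 'I_(size s) -> A,
    m = \sum_i c i *: s`_i.

(* W with i : A -> W is the extension of scalars of A along f : k -> F, that is
   the F-vector space F tensor_k A, given by its universal property. *)
Section BaseChange.
Variables (k : comNzRingType) (F : fieldType) (f : {rmorphism k -> F}).
Variable A : kalg k.

Definition semilinear (W : lmodType F) (g : A -> W) : Prop :=
  forall c x y, g (scal A c * x + y) = f c *: g x + g y.

Definition is_base_change (W : lmodType F) (i : A -> W) : Prop :=
  semilinear i /\
  forall (U : lmodType F) (g : A -> U), semilinear g ->
    exists h : {linear W -> U}, (forall x, h (i x) = g x) /\
      forall h' : {linear W -> U}, (forall x, h' (i x) = g x) -> h' =1 h.
End BaseChange.

Definition fin_dim_over_fields (k : comNzRingType) (A : kalg k) : Prop :=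
  forall (F : fieldType) (f : {rmorphism k -> F}),
    exists (W : lmodType F) (i : A -> W), is_base_change f i /\ fin_gen W.

Section VertexIdempotents.
Variables (A : pzRingType) (n : nat) (e : 'I_n -> A).

Definition complete_orthogonal (I : finType) (e : I -> A) : Prop :=
  [/\ forall i, e i * e i = e i, forall i j, i != j -> e i * e j = 0
    & \sum_i e i = 1].

(* a lies in e_v A e_u. *)
Definition in_block (v u : 'I_n) (a : A) : Prop := e v * a * e u = a.

(* ar is a section of a, where ta = u and ha = v. *)
Definition is_section (u v : 'I_n) (a ar : A) : Prop :=
  [/\ u != v, in_block v u a, in_block u v ar & a * ar = e v].
End VertexIdempotents.

Section Relations.
Variables (k : comNzRingType) (n : nat) (Q : quiver n).
Variable R : path_alg k Q -> Prop.

Definition rel_alg : kalg k := @kquot k (path_kalg k Q) R.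
Definition rel_path (p : qpath Q) : rel_alg := quot_pi R (path_elt k p).
Definition rel_vertex (v : 'I_n) : rel_alg := rel_path (path_triv Q v).
Definition rel_arrow (a : Q) : rel_alg := rel_path (path_arrow a).

(* The arrow ar is a section of the arrow a. *)
Definition arrow_section (a ar : Q) : Prop :=
  [/\ tl a != hd a, tl ar = hd a, hd ar = tl a
    & rel_arrow a * rel_arrow ar = rel_vertex (hd a)].
End Relations.

Record qrs (k : comNzRingType) (n : nat) := QRS {
  qrs_quiver : quiver n;
  qrs_rel : path_alg k qrs_quiver -> Prop;
  qrs_relP : forall r, qrs_rel r -> exists u v, forall p,
    p \in msupp r -> path_tail p = u /\ path_head p = v;
  qrs_sec : {set qrs_quiver};
  qrs_secP : forall ar, ar \in qrs_sec <->
    exists a, arrow_section qrs_rel a ar;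
  qrs_sec_proj : forall a, a \in qrs_sec ->
    ~ exists ar, arrow_section qrs_rel a ar;
  qrs_fin_dim : fin_dim_over_fields (rel_alg qrs_rel)
}.
Definition qrs_alg k n (Q : qrs k n) : kalg k := rel_alg (@qrs_rel k n Q).
Definition qrs_vertex k n (Q : qrs k n) : 'I_n -> qrs_alg Q :=
  rel_vertex (@qrs_rel k n Q).

Lemma qrs_vertexP k n (Q : qrs k n) : complete_orthogonal (@qrs_vertex k n Q).
Proof.
have E (u v : 'I_n) : qrs_vertex Q u * qrs_vertex Q v =
    quot_pi _ (path_mulb k (path_triv (qrs_quiver Q) u) (path_triv _ v)).
  by rewrite -rmorphM; congr (quot_pi _ _); apply: path_mul_elt.
split=> [v|u v uv|].
- rewrite E /path_mulb.
  have [//|r -> rE] := @path_comp_some _ _ (path_triv (qrs_quiver Q) v) (path_triv _ v).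
  by congr (quot_pi _ (path_elt _ _)); apply: val_inj; rewrite rE.
- by rewrite E /path_mulb path_comp_none ?raddf0 //; apply/eqP.
- by rewrite -raddf_sum.
Qed.

(* For an idempotent e, the left ideal Ae as a left A-module. *)
Section LeftIdeal.
Variables (A : pzRingType) (e : A).
Definition left_ideal_pred : {pred A} := fun x => x * e == x.
Record left_ideal := LeftIdeal { li_val : A; _ : left_ideal_pred li_val }.
HB.instance Definition _ := [isSub for li_val].
HB.instance Definition _ := [Choice of left_ideal by <:].
Lemma left_ideal_zmod : zmod_closed left_ideal_pred.
Proof.
split=> [|x y /eqP xe /eqP ye]; rewrite unfold_in /left_ideal_pred ?mul0r //.
by rewrite mulrBl xe ye.
Qed.
HB.instance Definition _ := GRing.isZmodClosed.Build A left_ideal_pred left_ideal_zmod.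
HB.instance Definition _ := [SubChoice_isSubZmodule of left_ideal by <:].
Lemma left_ideal_scale_subproof (a : A) (x : left_ideal) :
  left_ideal_pred (a * val x).
Proof. by rewrite /left_ideal_pred -mulrA (eqP (valP x)). Qed.
Definition left_ideal_scale a x := LeftIdeal (left_ideal_scale_subproof a x).
Lemma left_ideal_scaleA a b x :
  left_ideal_scale a (left_ideal_scale b x) = left_ideal_scale (a * b) x.
Proof. by apply: val_inj; rewrite /= mulrA. Qed.
Lemma left_ideal_scale1 : left_id 1 left_ideal_scale.
Proof. by move=> x; apply: val_inj; rewrite /= mul1r. Qed.
Lemma left_ideal_scaleDr : right_distributive left_ideal_scale +%R.
Proof. by move=> a x y; apply: val_inj; rewrite /= mulrDr. Qed.
Lemma left_ideal_scaleDl x : {morph left_ideal_scale^~ x : a b / a + b}.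
Proof. by move=> a b; apply: val_inj; rewrite /= mulrDl. Qed.
HB.instance Definition _ := GRing.Zmodule_isLmodule.Build A left_ideal
  left_ideal_scaleA left_ideal_scale1 left_ideal_scaleDr left_ideal_scaleDl.
End LeftIdeal.

Definition mod_iso (A : pzRingType) (M N : lmodType A) : Prop :=
  exists f : {linear M -> N}, bijective f.

Definition primitive (A : pzRingType) (e : A) : Prop :=
  [/\ e != 0, e * e = e
    & forall f g, f * f = f -> g * g = g -> f * g = 0 -> g * f = 0 ->
        e = f + g -> f = 0 \/ g = 0].

(* The e_ij are indexed by the pairs (i, j) with j : 'I_(m i).+1. The last two
   conditions say that bAb, b = sum_i e_i0, is the basic algebra of A: the
   modules A e_i0 represent each isomorphism class of the A e_ij exactly once. *)
Definition basic_partition (A : pzRingType) n (e : 'I_n -> A) : Prop :=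
  exists (m : 'I_n -> nat) (E : forall i, 'I_(m i).+1 -> A),
    let E' (ij : {i : 'I_n & 'I_(m i).+1}) := E (tag ij) (tagged ij) in
    [/\ complete_orthogonal E', forall ij, primitive (E' ij),
        forall i, e i = \sum_j E i j,
        forall i i', i != i' ->
          ~ mod_iso (left_ideal (E i ord0)) (left_ideal (E i' ord0))
      & forall ij, exists i, mod_iso (left_ideal (E' ij)) (left_ideal (E i ord0))].

Record category := Category {
  obj :> Type;
  hom : obj -> obj -> Type;
  idm : forall X, hom X X;
  comp : forall X Y Z, hom Y Z -> hom X Y -> hom X Z;
  comp1l : forall X Y (f : hom X Y), comp (idm Y) f = f;
  comp1r : forall X Y (f : hom X Y), comp f (idm X) = f;
  compA : forall X Y Z W (h : hom Z W) (g : hom Y Z) (f : hom X Y),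
    comp h (comp g f) = comp (comp h g) f
}.
Arguments hom {c}.
Arguments idm {c}.
Arguments comp {c X Y Z}.

Record functor (C D : category) := Functor {
  fobj :> C -> D;
  fmap : forall X Y, hom X Y -> hom (fobj X) (fobj Y);
  fmap1 : forall X, fmap (idm X) = idm (fobj X);
  fmapM : forall X Y Z (g : hom Y Z) (f : hom X Y),
    fmap (comp g f) = comp (fmap g) (fmap f)
}.
Arguments fmap {C D} f {X Y} : rename.

Definition functor_id (C : category) : functor C C :=
  @Functor C C id (fun _ _ f => f) (fun _ => erefl) (fun _ _ _ _ _ => erefl).

Lemma functor_comp1 C D E (G : functor D E) (F : functor C D) (X : C) :
  fmap G (fmap F (idm X)) = idm (G (F X)).
Proof. by rewrite !fmap1. Qed.
Lemma functor_compM C D E (G : functor D E) (F : functor C D)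
  (X Y Z : C) (g : hom Y Z) (f : hom X Y) :
  fmap G (fmap F (comp g f)) = comp (fmap G (fmap F g)) (fmap G (fmap F f)).
Proof. by rewrite !fmapM. Qed.
Definition functor_comp C D E (G : functor D E) (F : functor C D) :
    functor C E :=
  Functor (@functor_comp1 C D E G F) (@functor_compM C D E G F).

Record nat_trans C D (F G : functor C D) := NatTrans {
  nt :> forall X, hom (F X) (G X);
  nt_natural : forall X Y (f : hom X Y),
    comp (nt Y) (fmap F f) = comp (fmap G f) (nt X)
}.

Definition is_iso (C : category) (X Y : C) (f : hom X Y) : Prop :=
  exists g : hom Y X, comp g f = idm X /\ comp f g = idm Y.

Definition nat_iso C D (F G : functor C D) (t : nat_trans F G) : Prop :=
  forall X, is_iso (t X).

Definition equivalent (C D : category) : Prop :=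
  exists (F : functor C D) (G : functor D C)
    (s : nat_trans (functor_id C) (functor_comp G F))
    (t : nat_trans (functor_comp F G) (functor_id D)), nat_iso s /\ nat_iso t.

Record adjunction C D (F : functor C D) (G : functor D C) := Adjunction {
  adj_unit : nat_trans (functor_id C) (functor_comp G F);
  adj_counit : nat_trans (functor_comp F G) (functor_id D);
  adj_triangle1 : forall X, comp (adj_counit (F X)) (fmap F (adj_unit X)) = idm (F X);
  adj_triangle2 : forall Y, comp (fmap G (adj_counit Y)) (adj_unit (G Y)) = idm (G Y)
}.

(* G is right adjoint to F and a quasi-inverse of F. *)
Definition inverse_right_adjoint C D (F : functor C D) (G : functor D C) : Prop :=
  exists a : adjunction F G, nat_iso (adj_unit a) /\ nat_iso (adj_counit a).

Lemma linear_ext (A : pzRingType) (M N : lmodType A) (f g : {linear M -> N}) :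
  f =1 g -> f = g.
Proof.
case: f => f [[f1] [f2]]; case: g => g [[g1] [g2]] /= /funext fg.
subst g; congr GRing.Linear.Pack.
by congr GRing.Linear.Class; congr (_ _); apply: Prop_irrelevance.
Qed.

Record fgmod (A : pzRingType) := FgMod {
  fg_mod :> lmodType A;
  fg_modP : fin_gen fg_mod
}.

Section ModCat.
Variable A : pzRingType.
Definition lin_id (M : fgmod A) : {linear M -> M} := idfun.
Definition lin_comp (M N L : fgmod A) (g : {linear N -> L}) (f : {linear M -> N}) :
  {linear M -> L} := g \o f.
Lemma lin_comp1l (M N : fgmod A) (f : {linear M -> N}) : lin_comp (lin_id N) f = f.
Proof. exact: linear_ext. Qed.
Lemma lin_comp1r (M N : fgmod A) (f : {linear M -> N}) : lin_comp f (lin_id M) = f.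
Proof. exact: linear_ext. Qed.
Lemma lin_compA (M N L K : fgmod A) (h : {linear L -> K}) (g : {linear N -> L})
  (f : {linear M -> N}) : lin_comp h (lin_comp g f) = lin_comp (lin_comp h g) f.
Proof. exact: linear_ext. Qed.
Definition modcat : category := Category lin_comp1l lin_comp1r lin_compA.
End ModCat.

Definition morita_equivalent (A B : pzRingType) : Prop :=
  equivalent (modcat A) (modcat B).

Definition projective (A : pzRingType) (P : lmodType A) : Prop :=
  forall (M N : lmodType A) (g : {linear M -> N}) (f : {linear P -> N}),
    (forall y, exists x, g x = y) -> exists h : {linear P -> M}, g \o h =1 f.

(* The external direct sum of a finite family of modules. *)
Section DirectSum.
Variables (A : pzRingType) (I : finType) (T : I -> lmodType A).
Definition dsum := forall i, T i.
HB.instance Definition _ := Choice.on dsum.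
Definition dsum_add (x y : dsum) : dsum := fun i => x i + y i.
Definition dsum_opp (x : dsum) : dsum := fun i => - x i.
Definition dsum_zero : dsum := fun=> 0.
Lemma dsum_addA : associative dsum_add.
Proof. by move=> x y z; apply: functional_extensionality_dep => i; apply: addrA. Qed.
Lemma dsum_addC : commutative dsum_add.
Proof. by move=> x y; apply: functional_extensionality_dep => i; apply: addrC. Qed.
Lemma dsum_add0 : left_id dsum_zero dsum_add.
Proof. by move=> x; apply: functional_extensionality_dep => i; apply: add0r. Qed.
Lemma dsum_addN : left_inverse dsum_zero dsum_opp dsum_add.
Proof. by move=> x; apply: functional_extensionality_dep => i; apply: addNr. Qed.
HB.instance Definition _ :=
  GRing.isZmodule.Build dsum dsum_addA dsum_addC dsum_add0 dsum_addN.
Definition dsum_scale (a : A) (x : dsum) : dsum := fun i => a *: x i.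
Lemma dsum_scaleA a b x : dsum_scale a (dsum_scale b x) = dsum_scale (a * b) x.
Proof. by apply: functional_extensionality_dep => i; apply: scalerA. Qed.
Lemma dsum_scale1 : left_id 1 dsum_scale.
Proof. by move=> x; apply: functional_extensionality_dep => i; apply: scale1r. Qed.
Lemma dsum_scaleDr : right_distributive dsum_scale +%R.
Proof. by move=> a x y; apply: functional_extensionality_dep => i; apply: scalerDr. Qed.
Lemma dsum_scaleDl x : {morph dsum_scale^~ x : a b / a + b}.
Proof. by move=> a b; apply: functional_extensionality_dep => i; apply: scalerDl. Qed.
HB.instance Definition _ := GRing.Zmodule_isLmodule.Build A dsum
  dsum_scaleA dsum_scale1 dsum_scaleDr dsum_scaleDl.
End DirectSum.

(* The ring eAe, with unit e. *)
Section Corner.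
Variables (A : pzRingType) (e : A).
Definition corner_pred : {pred A} := fun x => e * x * e == x.
Lemma corner_zmod : zmod_closed corner_pred.
Proof.
split=> [|x y /eqP xe /eqP ye]; rewrite unfold_in /corner_pred ?mulr0 ?mul0r //.
by rewrite mulrBr mulrBl xe ye.
Qed.
HB.instance Definition _ := GRing.isZmodClosed.Build A corner_pred corner_zmod.

Variable ee : e * e = e.
Record corner_of (idem : e * e = e) := Corner { cor_val : A; _ : corner_pred cor_val }.
Local Notation corner := (corner_of ee).
HB.instance Definition _ := [isSub for @cor_val ee].
HB.instance Definition _ := [Choice of corner by <:].
HB.instance Definition _ := [SubChoice_isSubZmodule of corner by <:].

Lemma corner_compr_subproof (a : A) : corner_pred (e * a * e).
Proof. by rewrite /corner_pred !mulrA ee -!mulrA ee. Qed.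
(* c |-> ece *)
Definition corner_compr (c : A) : corner := Corner ee (corner_compr_subproof c).

Lemma corner_el (x : corner) : e * val x = val x.
Proof. by rewrite -(eqP (valP x)) !mulrA ee. Qed.
Lemma corner_er (x : corner) : val x * e = val x.
Proof. by rewrite -(eqP (valP x)) -!mulrA ee. Qed.

Lemma corner_one_subproof : corner_pred e.
Proof. by rewrite /corner_pred !ee. Qed.
Definition corner_one : corner := Corner ee corner_one_subproof.
Lemma corner_mul_subproof (x y : corner) : corner_pred (val x * val y).
Proof. by rewrite /corner_pred mulrA corner_el -mulrA corner_er. Qed.
Definition corner_mul x y : corner := Corner ee (corner_mul_subproof x y).
Lemma corner_mulA : associative corner_mul.
Proof. by move=> x y z; apply: val_inj; apply: mulrA. Qed.
Lemma corner_mul1l : left_id corner_one corner_mul.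
Proof. by move=> x; apply: val_inj; apply: corner_el. Qed.
Lemma corner_mul1r : right_id corner_one corner_mul.
Proof. by move=> x; apply: val_inj; apply: corner_er. Qed.
Lemma corner_mulDl : left_distributive corner_mul +%R.
Proof. by move=> x y z; apply: val_inj; apply: mulrDl. Qed.
Lemma corner_mulDr : right_distributive corner_mul +%R.
Proof. by move=> x y z; apply: val_inj; apply: mulrDr. Qed.
HB.instance Definition _ := GRing.Zmodule_isPzRing.Build corner
  corner_mulA corner_mul1l corner_mul1r corner_mulDl corner_mulDr.
End Corner.

Section KCorner.
Variables (k : comNzRingType) (A : kalg k) (e : A) (ee : e * e = e).
Definition corner_scal (c : k) : corner_of ee := corner_compr ee (scal A c).
Lemma corner_scal_additive : zmod_morphism corner_scal.
Proof. by move=> c d; apply: val_inj; rewrite /= rmorphB mulrBr mulrBl. Qed.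
Lemma corner_scalE c : e * scal A c * e = scal A c * e.
Proof. by rewrite -scalC -mulrA ee. Qed.
Lemma corner_scal_multiplicative : monoid_morphism corner_scal.
Proof.
split=> [|c d]; apply: val_inj; rewrite /= !corner_scalE ?rmorph1 ?mul1r //.
by rewrite rmorphM -!mulrA [e * (_ * e)]mulrA corner_scalE.
Qed.
HB.instance Definition _ :=
  GRing.isZmodMorphism.Build k (corner_of ee) corner_scal corner_scal_additive.
HB.instance Definition _ :=
  GRing.isMonoidMorphism.Build k (corner_of ee) corner_scal corner_scal_multiplicative.
Lemma corner_scalC c x : corner_scal c * x = x * corner_scal c.
Proof.
apply: val_inj; rewrite /= corner_scalE -mulrA corner_el //.
by rewrite scalC -{1}(corner_er x) -!mulrA scalC.
Qed.
Definition kcorner : kalg k := KAlg corner_scalC.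
End KCorner.

(* The functor e(-) from A-modules to eAe-modules. *)
Section CornerModule.
Variables (A : pzRingType) (e : A) (ee : e * e = e) (M : lmodType A).
Definition cornerm_pred : {pred M} := fun m => e *: m == m.
Lemma cornerm_zmod : zmod_closed cornerm_pred.
Proof.
split=> [|x y /eqP xe /eqP ye]; rewrite unfold_in /cornerm_pred ?scaler0 //.
by rewrite scalerBr xe ye.
Qed.
HB.instance Definition _ := GRing.isZmodClosed.Build M cornerm_pred cornerm_zmod.
Record cornerm_of (idem : e * e = e) := CornerM { corm_val : M; _ : cornerm_pred corm_val }.
Local Notation cornerm := (cornerm_of ee).
HB.instance Definition _ := [isSub for @corm_val ee].
HB.instance Definition _ := [Choice of cornerm by <:].
HB.instance Definition _ := [SubChoice_isSubZmodule of cornerm by <:].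
Lemma cornerm_scale_subproof (b : corner_of ee) (m : cornerm) :
  cornerm_pred (val b *: val m).
Proof. by rewrite /cornerm_pred scalerA corner_el. Qed.
Definition cornerm_scale b m : cornerm := CornerM ee (cornerm_scale_subproof b m).
Lemma cornerm_scaleA a b m :
  cornerm_scale a (cornerm_scale b m) = cornerm_scale (a * b) m.
Proof. by apply: val_inj; rewrite /= scalerA. Qed.
Lemma cornerm_scale1 : left_id 1 cornerm_scale.
Proof. by move=> m; apply: val_inj; rewrite /= (eqP (valP m)). Qed.
Lemma cornerm_scaleDr : right_distributive cornerm_scale +%R.
Proof. by move=> a x y; apply: val_inj; rewrite /= scalerDr. Qed.
Lemma cornerm_scaleDl m : {morph cornerm_scale^~ m : a b / a + b}.
Proof. by move=> a b; apply: val_inj; rewrite /= scalerDl. Qed.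
HB.instance Definition _ := GRing.Zmodule_isLmodule.Build (corner_of ee) cornerm
  cornerm_scaleA cornerm_scale1 cornerm_scaleDr cornerm_scaleDl.
End CornerModule.

Section CornerMap.
Variables (A : pzRingType) (e : A) (ee : e * e = e) (M N : lmodType A).
Variable f : {linear M -> N}.
Lemma cornerm_map_subproof (m : cornerm_of M ee) : cornerm_pred e (f (val m)).
Proof. by rewrite /cornerm_pred -linearZ (eqP (valP m)). Qed.
Definition cornerm_map m : cornerm_of N ee := CornerM ee (cornerm_map_subproof m).
Lemma cornerm_map_linear : linear cornerm_map.
Proof. by move=> a x y; apply: val_inj; rewrite /= linearP. Qed.
HB.instance Definition _ := GRing.isLinear.Build (corner_of ee) (cornerm_of M ee)
  (cornerm_of N ee) *:%R cornerm_map cornerm_map_linear.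
End CornerMap.

Section CornerFunctor.
Variables (A : pzRingType) (e : A) (ee : e * e = e).
Hypothesis fgM : forall M : lmodType A, fin_gen M -> fin_gen (cornerm_of M ee).
Definition cornerF_obj (M : modcat A) : modcat (corner_of ee) := FgMod (fgM (fg_modP M)).
Definition cornerF_map (M N : modcat A) (f : hom M N) :
  hom (cornerF_obj M) (cornerF_obj N) := @cornerm_map A e ee M N f.
Lemma cornerF_map1 M : cornerF_map (idm M) = idm (cornerF_obj M).
Proof. by apply: linear_ext => m; apply: val_inj. Qed.
Lemma cornerF_mapM (M N L : modcat A) (g : hom N L) (f : hom M N) :
  cornerF_map (comp g f) = comp (cornerF_map g) (cornerF_map f).
Proof. by apply: linear_ext => m; apply: val_inj. Qed.
Definition cornerF : functor (modcat A) (modcat (corner_of ee)) :=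
  Functor cornerF_map1 cornerF_mapM.
End CornerFunctor.

(* A right action of A on the left B-module P making it a (B, A)-bimodule on
   which k acts centrally. *)
Record right_action (k : comNzRingType) (B A : kalg k) (P : lmodType B) := RightAction {
  ract :> P -> A -> P;
  ract_linear : forall a, linear (ract^~ a);
  ractD : forall p, {morph ract p : a b / a + b};
  ract1 : forall p, ract p 1 = p;
  ractM : forall p a b, ract p (a * b) = ract (ract p a) b;
  ract_scal : forall p c, ract p (scal A c) = scal B c *: p
}.

(* Hom_B(P, N) with the left A-action (a f)(p) = f (p a). *)
Section HomModule.
Variables (k : comNzRingType) (B A : kalg k) (P : lmodType B).
Variables (r : right_action A P) (N : lmodType B).
Definition hom_mod_of (_ : right_action A P) := {linear P -> N}.
Local Notation hom_mod := (hom_mod_of r).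
HB.instance Definition _ := gen_eqMixin hom_mod.
HB.instance Definition _ := gen_choiceMixin hom_mod.
Definition hom_fun (f : hom_mod) : {linear P -> N} := f.
Definition hom_add (f g : hom_mod) : hom_mod :=
  GRing.Linear.clone _ _ _ _ (hom_fun f \+ hom_fun g) _.
Definition hom_opp (f : hom_mod) : hom_mod :=
  GRing.Linear.clone _ _ _ _ (\- hom_fun f) _.
Definition hom_zero : hom_mod := GRing.Linear.clone _ _ _ _ (GRing.null_fun N : P -> N) _.
Lemma hom_addA : associative hom_add.
Proof. by move=> f g h; apply: linear_ext => p; apply: addrA. Qed.
Lemma hom_addC : commutative hom_add.
Proof. by move=> f g; apply: linear_ext => p; apply: addrC. Qed.
Lemma hom_add0 : left_id hom_zero hom_add.
Proof. by move=> f; apply: linear_ext => p; apply: add0r. Qed.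
Lemma hom_addN : left_inverse hom_zero hom_opp hom_add.
Proof. by move=> f; apply: linear_ext => p; apply: addNr. Qed.
HB.instance Definition _ :=
  GRing.isZmodule.Build hom_mod hom_addA hom_addC hom_add0 hom_addN.

Definition hom_scale_fun (a : A) (f : hom_mod) (p : P) : N := hom_fun f (r p a).
Lemma hom_scale_linear a f : linear (hom_scale_fun a f).
Proof. by move=> b p q; rewrite /hom_scale_fun ract_linear linearP. Qed.
HB.instance Definition _ a f :=
  GRing.isLinear.Build B P N *:%R (hom_scale_fun a f) (hom_scale_linear a f).
Definition hom_scale a f : hom_mod := GRing.Linear.clone _ _ _ _ (hom_scale_fun a f) _.
Lemma hom_scaleA a b f : hom_scale a (hom_scale b f) = hom_scale (a * b) f.
Proof. by apply: linear_ext => p; rewrite /= /hom_scale_fun /= /hom_scale_fun ractM. Qed.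
Lemma hom_scale1 : left_id 1 hom_scale.
Proof. by move=> f; apply: linear_ext => p; rewrite /= /hom_scale_fun ract1. Qed.
Lemma hom_scaleDr : right_distributive hom_scale +%R.
Proof. by move=> a f g; apply: linear_ext. Qed.
Lemma hom_scaleDl f : {morph hom_scale^~ f : a b / a + b}.
Proof.
by move=> a b; apply: linear_ext => p; rewrite /= /hom_scale_fun ractD linearD.
Qed.
HB.instance Definition _ := GRing.Zmodule_isLmodule.Build A hom_mod
  hom_scaleA hom_scale1 hom_scaleDr hom_scaleDl.
End HomModule.

Section HomFunctor.
Variables (k : comNzRingType) (B A : kalg k) (P : lmodType B) (r : right_action A P).
Definition hom_map (M N : lmodType B) (g : {linear M -> N}) (f : hom_mod_of M r) :
  hom_mod_of N r := GRing.Linear.clone _ _ _ _ (g \o hom_fun f) _.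
Lemma hom_map_linear M N g : linear (@hom_map M N g).
Proof. by move=> a f h; apply: linear_ext => p; rewrite /= linearD. Qed.
HB.instance Definition _ M N g :=
  GRing.isLinear.Build A _ _ *:%R (@hom_map M N g) (hom_map_linear g).

Hypothesis fgP : forall N : lmodType B, fin_gen N -> fin_gen (hom_mod_of N r).
Definition homF_obj (N : modcat B) : modcat A := FgMod (fgP (fg_modP N)).
Definition homF_map (M N : modcat B) (g : hom M N) : hom (homF_obj M) (homF_obj N) :=
  hom_map g.
Lemma homF_map1 M : homF_map (idm M) = idm (homF_obj M).
Proof. by apply: linear_ext => f; apply: linear_ext. Qed.
Lemma homF_mapM (M N L : modcat B) (g : hom N L) (f : hom M N) :
  homF_map (comp g f) = comp (homF_map g) (homF_map f).
Proof. by apply: linear_ext => h; apply: linear_ext. Qed.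
Definition homF : functor (modcat B) (modcat A) := Functor homF_map1 homF_mapM.
End HomFunctor.

(* For an A-module M, the k-module eM; for e = e_v this is M(v). *)
Section VertexPart.
Variables (k : comNzRingType) (A : kalg k) (e : A) (M : lmodType A).
Record vpart := VPart { vp_val : M; _ : cornerm_pred e vp_val }.
HB.instance Definition _ := [isSub for vp_val].
HB.instance Definition _ := [Choice of vpart by <:].
HB.instance Definition _ := [SubChoice_isSubZmodule of vpart by <:].
Lemma vpart_scale_subproof (c : k) (m : vpart) : cornerm_pred e (scal A c *: val m).
Proof. by rewrite /cornerm_pred scalerA -scalC -scalerA (eqP (valP m)). Qed.
Definition vpart_scale c m := VPart (vpart_scale_subproof c m).
Lemma vpart_scaleA a b m : vpart_scale a (vpart_scale b m) = vpart_scale (a * b) m.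
Proof. by apply: val_inj; rewrite /= scalerA rmorphM. Qed.
Lemma vpart_scale1 : left_id 1 vpart_scale.
Proof. by move=> m; apply: val_inj; rewrite /= rmorph1 scale1r. Qed.
Lemma vpart_scaleDr : right_distributive vpart_scale +%R.
Proof. by move=> a x y; apply: val_inj; rewrite /= scalerDr. Qed.
Lemma vpart_scaleDl m : {morph vpart_scale^~ m : a b / a + b}.
Proof. by move=> a b; apply: val_inj; rewrite /= rmorphD scalerDl. Qed.
HB.instance Definition _ := GRing.Zmodule_isLmodule.Build k vpart
  vpart_scaleA vpart_scale1 vpart_scaleDr vpart_scaleDl.
End VertexPart.

(* The map eM -> fM, m |-> f a m; for a in fAe this is the action m |-> a m. *)
Section VertexAction.
Variables (k : comNzRingType) (A : kalg k) (M : lmodType A).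
Variables (e f : A) (ff : f * f = f) (a : A).
Lemma vact_subproof (m : vpart e M) : cornerm_pred f (f *: (a *: val m)).
Proof. by rewrite /cornerm_pred scalerA ff. Qed.
Definition vact (m : vpart e M) : vpart f M := VPart (vact_subproof m).
End VertexAction.

Definition is_cokernel (R : pzRingType) (U V W : lmodType R) (f : U -> V)
    (p : V -> W) : Prop :=
  (forall w, exists x, p x = w) /\ forall x, p x = 0 <-> exists u, x = f u.

(* An element to break at, with its tail, its head and its chosen section. *)
Record bstep (A : Type) (n : nat) := BStep {
  st_tl : 'I_n;
  st_hd : 'I_n;
  st_el : A;
  st_sec : A
}.

Definition elem_mx (n : nat) (u v : 'I_n) : 'M[nat]_n := 1%:M + delta_mx u v.

(* Sequences are listed as in the notation Br_(a_k, ..., a_1): the head of the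
   list is a_k, the last element to break at. *)
Definition break_mx A n (s : seq (bstep A n)) : 'M[nat]_n :=
  foldr (fun x M => M *m elem_mx (st_tl x) (st_hd x)) 1%:M s.

(* All the rings obtained by iterated breaking are subsets of A: the stage of a
   sequence consists of the unit e of the ring eAe obtained by breaking at it,
   its inherited vertex idempotents, and the map Br from A to eAe. *)
Record stage (A : Type) n := Stage {
  sg_unit : A;
  sg_vertex : 'I_n -> A;
  sg_br : A -> A
}.

Section Breaking.
Variables (k : comNzRingType) (A : kalg k) (n : nat) (e : 'I_n -> A).
Implicit Types (s : seq (bstep A n)).

Fixpoint broken s : stage A n :=
  if s is x :: s' then
    let B := broken s' in
    let a := sg_br B (st_el x) in
    let ar := sg_br B (st_sec x) in
    let e' := sg_unit B - ar * a in
    Stage e'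
      (fun v => if v == st_tl x then sg_vertex B v - ar * a else sg_vertex B v)
      (fun c => e' * sg_br B c * e')
  else Stage 1 e id.

Fixpoint is_breaking s : Prop :=
  if s is x :: s' then
    let B := broken s' in
    [/\ is_breaking s', in_block e (st_hd x) (st_tl x) (st_el x),
        in_block e (st_tl x) (st_hd x) (st_sec x)
      & is_section (sg_vertex B) (st_tl x) (st_hd x)
          (sg_br B (st_el x)) (sg_br B (st_sec x))]
  else True.

Hypothesis eP : complete_orthogonal e.

Record stage_inv (B : stage A n) : Prop := StageInv {
  inv_idem : forall v, sg_vertex B v * sg_vertex B v = sg_vertex B v;
  inv_orth : forall u v, u != v -> sg_vertex B u * sg_vertex B v = 0;
  inv_sum : \sum_v sg_vertex B v = sg_unit B;
  inv_l : forall v, e v * sg_vertex B v = sg_vertex B v;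
  inv_r : forall v, sg_vertex B v * e v = sg_vertex B v;
  inv_br : forall c, sg_br B c = sg_unit B * c * sg_unit B
}.

Section Inv.
Variables (B : stage A n) (BP : stage_inv B).
Lemma inv_ul v : sg_unit B * sg_vertex B v = sg_vertex B v.
Proof.
rewrite -(inv_sum BP) mulr_suml (bigD1 v) //= inv_idem // big1 ?addr0 //.
by move=> i iv; rewrite inv_orth.
Qed.
Lemma inv_ur v : sg_vertex B v * sg_unit B = sg_vertex B v.
Proof.
rewrite -(inv_sum BP) mulr_sumr (bigD1 v) //= inv_idem // big1 ?addr0 //.
by move=> i iv; rewrite inv_orth // eq_sym.
Qed.
Lemma inv_uu : sg_unit B * sg_unit B = sg_unit B.
Proof.
by rewrite -{2}(inv_sum BP) mulr_sumr; under eq_bigr do rewrite inv_ul; apply: inv_sum.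
Qed.
Lemma inv_ue v : sg_unit B * e v = sg_vertex B v.
Proof.
rewrite -(inv_sum BP) mulr_suml (bigD1 v) //= inv_r // big1 ?addr0 // => i iv.
by case: eP => _ eO _; rewrite -(inv_r BP) -mulrA eO // mulr0.
Qed.
Lemma inv_eu v : e v * sg_unit B = sg_vertex B v.
Proof.
rewrite -(inv_sum BP) mulr_sumr (bigD1 v) //= inv_l // big1 ?addr0 // => i iv.
by case: eP => _ eO _; rewrite -(inv_l BP) mulrA eO ?mul0r // eq_sym.
Qed.
Lemma inv_block u v a : in_block e v u a ->
  sg_br B a = sg_vertex B v * a * sg_vertex B u.
Proof.
move=> eae; rewrite (inv_br BP) -[in LHS]eae !mulrA inv_ue -!mulrA inv_eu mulrA.
by rewrite -mulrA.
Qed.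
End Inv.

Lemma stage_inv_step B x : stage_inv B ->
    in_block e (st_hd x) (st_tl x) (st_el x) ->
    in_block e (st_tl x) (st_hd x) (st_sec x) ->
    is_section (sg_vertex B) (st_tl x) (st_hd x)
          (sg_br B (st_el x)) (sg_br B (st_sec x)) ->
  let a := sg_br B (st_el x) in
  let ar := sg_br B (st_sec x) in
  let e' := sg_unit B - ar * a in
  stage_inv (Stage e'
      (fun v => if v == st_tl x then sg_vertex B v - ar * a else sg_vertex B v)
      (fun c => e' * sg_br B c * e')).
Proof.
move: (st_tl x) (st_hd x) (st_el x) (st_sec x) => u v a0 ar0 BP a0b ar0b.
set f := sg_vertex B; set a := sg_br B a0; set ar := sg_br B ar0.
case=> uv _ _ aar /=.
have fa : f v * a = a by rewrite /a (inv_block BP a0b) !mulrA (inv_idem BP).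
have af : a * f u = a by rewrite /a (inv_block BP a0b) -!mulrA (inv_idem BP).
have far : f u * ar = ar by rewrite /ar (inv_block BP ar0b) !mulrA (inv_idem BP).
have arf : ar * f v = ar by rewrite /ar (inv_block BP ar0b) -!mulrA (inv_idem BP).
set p := ar * a; set e' := sg_unit B - p.
have pp : p * p = p by rewrite /p mulrA -(mulrA ar) aar arf.
have fp : f u * p = p by rewrite /p mulrA far.
have pf : p * f u = p by rewrite /p -mulrA af.
have fp0 w : w != u -> f w * p = 0 by move=> wu; rewrite -fp mulrA (inv_orth BP) ?mul0r.
have pf0 w : w != u -> p * f w = 0.
  by move=> wu; rewrite -pf -mulrA (inv_orth BP) ?mulr0 // eq_sym.
have ue' : sg_unit B * e' = e'.
  by rewrite /e' mulrBr (inv_uu BP) mulrA -[in LHS]far mulrA (inv_ul BP) far.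
have e'u : e' * sg_unit B = e'.
  by rewrite /e' mulrBl (inv_uu BP) -mulrA -[in LHS]af -mulrA (inv_ur BP) af.
split=> /=.
- move=> w; case: eqP => [->|_]; last exact: (inv_idem BP).
  by rewrite mulrBl !mulrBr (inv_idem BP) fp pf pp subrr subr0.
- move=> w w' ww'; case: eqP => [wu|/eqP wu]; case: eqP => [w'u|/eqP w'u].
  + by rewrite wu w'u eqxx in ww'.
  + by rewrite mulrBl (inv_orth BP ww') pf0 // subrr.
  + by rewrite mulrBr (inv_orth BP ww') fp0 // subrr.
  + exact: (inv_orth BP).
- rewrite (bigD1 u) //= eqxx /e' -(inv_sum BP) [in RHS](bigD1 u) //= addrAC.
  by congr (_ + _ - _); apply: eq_bigr => w /negPf ->.
- move=> w; case: eqP => [->|_]; rewrite ?mulrBr (inv_l BP) //.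
  by rewrite -[in LHS]fp mulrA (inv_l BP) fp.
- move=> w; case: eqP => [->|_]; rewrite ?mulrBl (inv_r BP) //.
  by rewrite -[in LHS]pf -mulrA (inv_r BP) pf.
- by move=> c; rewrite (inv_br BP) !mulrA e'u -!mulrA ue'.
Qed.

Lemma brokenP s : is_breaking s -> stage_inv (broken s).
Proof.
elim: s => [|x s IH] /=; last by case=> /IH; apply: stage_inv_step.
move=> _; case: eP => ei eo e1; by split=> //= c; rewrite mul1r mulr1.
Qed.

Lemma broken_unit_idem s : is_breaking s ->
  sg_unit (broken s) * sg_unit (broken s) = sg_unit (broken s).
Proof. by move/brokenP/inv_uu. Qed.

(* The ring of the stage x :: s is Br_a(B) = e'Be', with B the ring of s. *)
Lemma broken_ring_cons x s : is_breaking (x :: s) -> forall c : A,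
  c \in corner_pred (sg_unit (broken (x :: s))) <->
  exists2 b, b \in corner_pred (sg_unit (broken s)) &
    c = sg_unit (broken (x :: s)) * b * sg_unit (broken (x :: s)).
Proof.
move=> hxs c; have hs : is_breaking s by case: hxs.
have BP := brokenP hs; have BP' := brokenP hxs.
set u := sg_unit (broken s); set u' := sg_unit (broken (x :: s)).
have uu := inv_uu BP; have u'u' := inv_uu BP'.
have E b : u' * (u * b * u) * u' = u' * b * u'.
  by rewrite -(inv_br BP); exact: (inv_br BP' b).
split=> [/eqP cE|[b _ ->]]; last first.
  by apply/eqP; rewrite !mulrA u'u' -!mulrA u'u'.
exists (u * c * u); last by rewrite E cE.
by apply/eqP; rewrite !mulrA uu -!mulrA uu.
Qed.

(* Likewise for the modules: the stage x :: s of M is e'(N), N the stage s. *)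
Lemma broken_mod_cons x s (M : lmodType A) : is_breaking (x :: s) -> forall m : M,
  m \in cornerm_pred (M := M) (sg_unit (broken (x :: s))) <->
  exists2 m', m' \in cornerm_pred (M := M) (sg_unit (broken s)) &
    m = sg_unit (broken (x :: s)) *: m'.
Proof.
move=> hxs m; have hs : is_breaking s by case: hxs.
have BP := brokenP hs; have BP' := brokenP hxs.
have uu := inv_uu BP; have u'u' := inv_uu BP'.
have u'u : sg_unit (broken (x :: s)) * sg_unit (broken s) =
    sg_unit (broken (x :: s)).
  case: hxs => _ xb _ _ /=; rewrite mulrBl uu -mulrA.
  by rewrite (inv_block BP xb) -!mulrA (inv_ur BP).
split=> [/eqP mE|[m' _ ->]]; last by apply/eqP; rewrite scalerA u'u'.
exists (sg_unit (broken s) *: m); last by rewrite scalerA u'u mE.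
by apply/eqP; rewrite scalerA uu.
Qed.

Lemma fin_gen_corner (u : A) (uu : u * u = u) (l : seq (A * A)) :
  1 = \sum_(p <- l) p.1 * u * p.2 ->
  forall M : lmodType A, fin_gen M -> fin_gen (cornerm_of M uu).
Proof.
move=> l1 M [g gP].
have mP (m : M) : cornerm_pred u (u *: m) by rewrite /cornerm_pred scalerA uu.
pose T : finType := ('I_(size l) * 'I_(size g))%type.
pose gen (t : T) : cornerm_of M uu := CornerM uu (mP ((l`_t.1).2 *: g`_t.2)).
exists [seq gen t | t <- enum {: T}] => m.
have [c cE] := gP (val m).
pose d (t : T) : corner_of uu := corner_compr uu (c t.2 * (l`_t.1).1).
have -> : m = \sum_(t : T) d t *: gen t.
  apply: val_inj; rewrite raddf_sum /= -(eqP (valP m)) {1}cE.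
  rewrite scaler_sumr -(pair_bigA _ (fun i j => val (d (i, j) *: gen (i, j)))) /=.
  rewrite exchange_big /=; apply: eq_bigr => j _.
  rewrite -[g`_j in LHS]scale1r l1 (big_nth 0) big_mkord scaler_suml !scaler_sumr.
  apply: eq_bigr => i _; rewrite !scalerA; congr (_ *: _).
  by rewrite -!mulrA (mulrA u u) uu.
have sT : size [seq gen t | t <- enum {: T}] = #|{: T}| by rewrite size_map cardE.
exists (fun i => d (enum_val (cast_ord sT i))).
rewrite (reindex (fun i => enum_val (cast_ord sT i))) /=; last first.
  exists (fun t => cast_ord (esym sT) (enum_rank t)) => [i _|t _].
    by rewrite enum_valK cast_ordK.
  by rewrite cast_ordKV enum_rankK.
apply: eq_bigr => i _; congr (_ *: _).
have iT : (i < size (enum {: T}))%N by rewrite -cardE -sT.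
rewrite (nth_map (enum_val (cast_ord sT i))) //; congr gen.
by rewrite [LHS](enum_val_nth (enum_val (cast_ord sT i))).
Qed.

Lemma broken_full s : is_breaking s ->
  exists l : seq (A * A), 1 = \sum_(p <- l) p.1 * sg_unit (broken s) * p.2.
Proof.
elim: s => [|x s IH] hxs; first by exists [:: (1, 1)]; rewrite big_seq1 !mulr1.
have hs : is_breaking s by case: hxs.
have [l lE] := IH hs; have BP := brokenP hs; have BP' := brokenP hxs.
case: (hxs) => _ ab arb [uv _ _ aar].
set B := broken s in aar BP lE; set a := sg_br _ _ in aar; set ar := sg_br _ _ in aar.
set e' := sg_unit (broken (x :: s)).
have e'E : e' = sg_unit B - ar * a by [].
have fa : sg_vertex B (st_hd x) * a = a.
  by rewrite /a (inv_block BP ab) !mulrA (inv_idem BP).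
have e'f : e' * sg_vertex B (st_hd x) = sg_vertex B (st_hd x).
  have /= := inv_ul BP' (st_hd x).
  by rewrite eq_sym (negPf uv).
have arf : ar * sg_vertex B (st_hd x) = ar.
  by rewrite /ar (inv_block BP arb) -!mulrA (inv_idem BP).
have uE : sg_unit B = e' + ar * e' * (sg_vertex B (st_hd x) * a).
  by rewrite !mulrA -(mulrA ar) e'f arf e'E subrK.
exists ([seq (p.1, p.2) | p <- l] ++
        [seq (p.1 * ar, sg_vertex B (st_hd x) * a * p.2) | p <- l]).
rewrite big_cat /= !big_map -big_split {1}lE; apply: eq_bigr => p _ /=.
by rewrite -/e' uE mulrDr mulrDl !mulrA.
Qed.

Section Broken.
Variables (s : seq (bstep A n)) (hs : is_breaking s).

Definition br_alg : kalg k := @kcorner k A (sg_unit (broken s)) (broken_unit_idem hs).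

Lemma br_vertex_subproof v : corner_pred (sg_unit (broken s)) (sg_vertex (broken s) v).
Proof. by rewrite /corner_pred (inv_ul (brokenP hs)) (inv_ur (brokenP hs)). Qed.
Definition br_vertex (v : 'I_n) : br_alg :=
  Corner (broken_unit_idem hs) (br_vertex_subproof v).

Definition br_mod (M : lmodType A) : lmodType br_alg :=
  cornerm_of M (broken_unit_idem hs).

Lemma br_fg (M : lmodType A) : fin_gen M -> fin_gen (br_mod M).
Proof. by have [l lE] := broken_full hs; apply: fin_gen_corner lE M. Qed.

Definition br_functor : functor (modcat A) (modcat br_alg) := cornerF br_fg.

(* P = sum_(u,v) M_uv P_v with P_v = B e^B_v *)
Definition br_proj : lmodType br_alg :=
  dsum (fun i : {uv : 'I_n * 'I_n & 'I_(break_mx s uv.1 uv.2)} =>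
          left_ideal (br_vertex (tag i).2)).

(* i : 'I_(size s) is the position in the list: later positions are broken
   earlier. *)
Definition st_at (i : 'I_(size s)) : bstep A n := tnth (in_tuple s) i.

(* Br_(a_(i-1), ..., a_1) of the element at position i and of its section, that
   is the elements by which the breaking at position i is performed. *)
Definition br_el (i : 'I_(size s)) : A :=
  sg_br (broken (drop i.+1 s)) (st_el (st_at i)).
Definition br_sec (i : 'I_(size s)) : A :=
  sg_br (broken (drop i.+1 s)) (st_sec (st_at i)).

(* No element with tail v has its head at a vertex whose idempotent was already
   replaced when it is broken. Then the unbroken a_i, a_i^r may be used at v
   instead of br_el i, br_sec i. In general they may not: for a_1 : u -> w and
   a_2 : v -> u with sections, breaking at a_1 then a_2 gives
   Br(M)(v) = Ker((e_u - a_1^r a_1) a_2), which is bigger than Ker(a_2). *)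
Definition heads_unbroken (v : 'I_n) : Prop :=
  forall i j : 'I_(size s), st_tl (st_at i) = v -> (i < j)%N ->
    st_tl (st_at j) != st_hd (st_at i).

(* Here a_i : M(v) -> M(ha_i) and a_i^r : M(ha_i) -> M(v) are the actions of the
   elements al i and be i, where i runs over the positions with ta_i = v.
   is_ker_coker says that, as subsets of M, Br(M)(v) is the intersection of the
   Ker(a_i), and that Br(M)(v) is the cokernel of the sum of the a_i^r by a
   k-linear map M(v) -> Br(M)(v) which is the identity on Br(M)(v). *)
Section AtVertex.
Variables (M : lmodType A) (v : 'I_n) (al be : 'I_(size s) -> A).
Definition st_from : finType := {i : 'I_(size s) | st_tl (st_at i) == v}.
Definition vertex_idem u : e u * e u = e u := let: And3 ei _ _ := eP in ei u.
Definition el_act (i : st_from) :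
    vpart (e v) M -> vpart (e (st_hd (st_at (val i)))) M :=
  vact (vertex_idem _) (al (val i)).
Definition sec_sum
    (y : dsum (fun i : st_from => vpart (e (st_hd (st_at (val i)))) M)) :
    vpart (e v) M :=
  \sum_i vact (vertex_idem v) (be (val i)) (y i).
Definition br_mod_at : lmodType k := @vpart k br_alg (br_vertex v) (br_mod M).
Definition br_mod_val (x : br_mod_at) : M := val (val x : br_mod M).

Definition is_ker_coker : Prop :=
  (forall m : M, (exists x, br_mod_val x = m) <->
     exists2 m', val m' = m & forall i, el_act i m' = 0) /\
  exists p : {linear vpart (e v) M -> br_mod_at},
    is_cokernel sec_sum p /\ forall m x, br_mod_val x = val m -> p m = x.
End AtVertex.
End Broken.
End Breaking.

(* Main.v *)
(* Let e' be the unit of B = e'Ae'. Each breaking replaces e_ta by the idempotents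
   e_ta - a^r a and a^r a, the latter being equivalent to e_ha = a a^r. Hence
   Ae'A = A, and the idempotent e_u of A is equivalent to the orthogonal sum of
   M_uv copies of e^B_v for each v: this is recorded by elements alpha_i of
   A e^B_v and beta_i of e^B_v A with beta_i alpha_j = delta_ij e^B_v and
   sum_i alpha_i beta_i = 1. Multiplication by the alpha_i identifies the
   bimodule e'A with P, and the Morita equivalence e'(-) has the inverse
   Hom_B(e'A, -). For (3), with a_i, a_i^r broken at the
   previous steps, e_v - e^B_v is the sum of the a_i^r a_i with ta_i = v,
   whereas a_i e^B_v = 0 and e^B_v a_i^r = 0. *)

From HB Require Import structures.
Require Import Defs.
From mathcomp Require Import all_boot all_algebra.
From mathcomp Require Import boolp.

Set Implicit Arguments.
Unset Strict Implicit.
Unset Printing Implicit Defensive.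

Import GRing.Theory.
Local Open Scope ring_scope.

(** * Natural isomorphisms, equivalences and finite generation *)

(** The inverses of the components, picked by choice, form a natural transformation: compose the
    naturality square of [t] with them on both sides. *)
Lemma nat_iso_inverse (C D : category) (F G : functor C D) (t : nat_trans F G) : nat_iso t ->
  exists t' : nat_trans G F, nat_iso t'.
Proof.
move=> ti; pose t' X := sval (cid (ti X)).
have t'l X : Defs.comp (t' X) (t X) = idm (F X) by rewrite /t'; case: cid => g [].
have t'r X : Defs.comp (t X) (t' X) = idm (G X) by rewrite /t'; case: cid => g [].
have nat X Y (f : Defs.hom X Y) : Defs.comp (t' Y) (fmap G f) = Defs.comp (fmap F f) (t' X).
  by rewrite -[fmap G f]comp1r -t'r (Defs.compA (fmap G f)) -nt_natural
             !Defs.compA t'l comp1l.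
by exists (NatTrans nat) => X; exists (t X).
Qed.

(** The equivalence starts at [D], so its two transformations run against the counit and the unit,
    and both have to be inverted. *)
Lemma inverse_right_adjoint_equivalent (C D : category) (F : functor C D)
    (G : functor D C) :
  inverse_right_adjoint F G -> equivalent D C.
Proof.
case=> a [/nat_iso_inverse[s si] /nat_iso_inverse[t ti]].
by exists G, F, t, s.
Qed.

Lemma bijective_is_iso (A : pzRingType) (M N : modcat A) (f : Defs.hom M N)
  (g : N -> M) : cancel (f : {linear M -> N}) g ->
  cancel g (f : {linear M -> N}) -> is_iso f.
Proof.
move=> fK gK; have gL : linear g := can2_linear fK gK.
pose h : {linear N -> M} := HB.pack g (GRing.isLinear.Build A N M *:%R g gL).
by exists h; split; apply: linear_ext => x; rewrite /= ?fK ?gK.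
Qed.

(** [h] is a mere function because it will be [row_hom], which goes between modules over different
    rings. *)
Lemma fin_gen_map (A : pzRingType) (M : lmodType A) (T : nmodType) (g : seq T)
    (h : T -> M) :
  (forall m, exists c : 'I_(size g) -> A, m = \sum_i c i *: h g`_i) -> fin_gen M.
Proof.
move=> hP; exists (map h g) => m; have [c ->] := hP m.
have E : size (map h g) = size g by rewrite size_map.
exists (c \o cast_ord E); rewrite (reindex (cast_ord E)) /=; last first.
  by exists (cast_ord (esym E)) => i _; rewrite ?cast_ordK ?cast_ordKV.
by apply: eq_bigr => i _; rewrite (nth_map 0) // -E.
Qed.

(** * The bimodule uA over B = uAu and the functor Hom_B(uA, -) *)

Section CornerHom.
Variables (k : comNzRingType) (A : kalg k) (u : A) (uu : u * u = u).
Local Notation B := (kcorner uu).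
Local Notation E := (cornerm_of (A^o : lmodType A) uu).

Lemma row_mulr_subproof (x : E) (a : A) :
  cornerm_pred u ((val x : A) * a : A^o).
Proof. by apply/eqP; rewrite [LHS]mulrA; congr (_ * _); apply/eqP/(valP x). Qed.
Definition row_mulr (x : E) (a : A) : E := CornerM uu (row_mulr_subproof x a).

Lemma row_ul (x : E) : u * (val x : A) = val x.
Proof. exact/eqP/(valP x). Qed.

Section Action.
Variables (P : lmodType B) (phi : {linear E -> P}) (psi : {linear P -> E}).
Hypotheses (phiK : cancel phi psi) (psiK : cancel psi phi).

(** Right multiplication on uA, carried to [P] along the isomorphism [phi]. *)
Definition row_ract (p : P) (a : A) : P := phi (row_mulr (psi p) a).
Lemma row_ract_linear a : linear (row_ract^~ a).
Proof.
move=> b p q; rewrite /row_ract -linearP; congr (phi _); apply: val_inj.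
by rewrite !linearP /= mulrDl -mulrA.
Qed.
Lemma row_ractD p : {morph row_ract p : a b / a + b}.
Proof.
by move=> a b; rewrite /row_ract -linearD; congr (phi _); apply: val_inj; apply: mulrDr.
Qed.
Lemma row_ract1 p : row_ract p 1 = p.
Proof.
by rewrite -[RHS]psiK /row_ract; congr (phi _); apply: val_inj; apply: mulr1.
Qed.
Lemma row_ractM p a b : row_ract p (a * b) = row_ract (row_ract p a) b.
Proof. by rewrite /row_ract phiK; congr (phi _); apply: val_inj; apply: mulrA. Qed.
(** As c is central, xc = (cu)x for x in uA, and cu is the image of c in B. *)
Lemma row_ract_scal p c : row_ract p (scal A c) = scal B c *: p.
Proof.
rewrite -[in RHS](psiK p) -linearZ; congr (phi _); apply: val_inj.
by rewrite /= corner_scalE // -scalC -[in LHS]row_ul; apply: mulrA.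
Qed.
Definition row_action : right_action A P :=
  RightAction row_ract_linear row_ractD row_ract1 row_ractM row_ract_scal.

Section Tensor.
Variable N : lmodType B.
(** As x lies in uA, this is x |-> xu. *)
Definition row_coord (x : E) : B := corner_compr uu (val x : A).
Definition row_hom_fun (y : N) (p : P) : N := row_coord (psi p) *: y.
Lemma row_hom_fun_linear y : linear (row_hom_fun y).
Proof.
move=> b p q; rewrite /row_hom_fun linearP scalerA -scalerDl; congr (_ *: _).
apply: val_inj; rewrite /= mulrDr mulrDl; congr (_ + _).
by rewrite (row_ul (psi p)) -[u * _]/(u * (cor_val b * val (psi p))) !mulrA corner_el.
Qed.
HB.instance Definition _ y :=
  GRing.isLinear.Build B P N *:%R (row_hom_fun y) (row_hom_fun_linear y).
(* Under Au (x)_B N = Hom_B(uA, N), this is u (x) y. *)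
Definition row_hom (y : N) : hom_mod_of N row_action :=
  GRing.Linear.clone _ _ _ _ (row_hom_fun y) _.

Lemma row_homE y p : hom_fun (row_hom y) p = row_coord (psi p) *: y.
Proof. by []. Qed.

(** This is B-linearity of [row_hom], with B acting on the target through its inclusion in A; it
    holds since (xb)u = (xu)b for b in B. *)
Lemma row_hom_sum I (r : seq I) (b : I -> B) (y : I -> N) :
  row_hom (\sum_(i <- r) b i *: y i) = \sum_(i <- r) val (b i) *: row_hom (y i).
Proof.
apply: linear_ext => p.
rewrite [RHS](big_morph (fun g : hom_mod_of N row_action => hom_fun g p)
  (fun _ _ => erefl) erefl).
rewrite [LHS]scaler_sumr; apply: eq_bigr => i _.
rewrite [RHS]row_homE /row_ract phiK scalerA; congr (_ *: _); apply: val_inj => /=.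
by rewrite -!mulrA corner_el corner_er.
Qed.

(** From (xu)u = xu; it puts [row_hom y] into u Hom_B(P, N), where the inverse of the counit takes
    its values. *)
Lemma row_hom_corner y : u *: row_hom y = row_hom y.
Proof.
apply: linear_ext => p; rewrite [LHS]row_homE [RHS]row_homE /row_ract phiK.
by congr (_ *: _); apply: val_inj; rewrite /= -!mulrA uu.
Qed.
End Tensor.

Lemma row_gen_subproof (a : A) : cornerm_pred u (u * a : A^o).
Proof. by apply/eqP; rewrite [LHS]mulrA uu. Qed.
Definition row_gen (a : A) : E := CornerM uu (row_gen_subproof a).

Section Eval.
Variable M : lmodType A.
Lemma row_eval_subproof (x : E) (m : M) : cornerm_pred u ((val x : A) *: m).
Proof. by apply/eqP; rewrite scalerA row_ul. Qed.
(** With x = [psi p] in uA this is x |-> xm; as m varies it becomes the unit of the adjunction. *)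
Definition row_eval (m : M) (p : P) : cornerm_of M uu :=
  CornerM uu (row_eval_subproof (psi p) m).
Lemma row_eval_linear m : linear (row_eval m).
Proof.
move=> b p q; rewrite /row_eval; apply: val_inj.
by rewrite /= linearP /= scalerDl -scalerA.
Qed.
HB.instance Definition _ m :=
  GRing.isLinear.Build B P (cornerm_of M uu) *:%R (row_eval m) (row_eval_linear m).
Definition row_unit (m : M) : hom_mod_of (cornerm_of M uu : lmodType B) row_action :=
  GRing.Linear.clone _ _ _ _ (row_eval m) _.
Lemma row_unit_linear : linear row_unit.
Proof.
move=> a m m'; apply: linear_ext => p; apply: val_inj.
by rewrite /= scalerDr /hom_scale_fun /= /row_ract phiK scalerA.
Qed.
HB.instance Definition _ :=
  GRing.isLinear.Build A M _ *:%R row_unit row_unit_linear.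
End Eval.

Section EvalUnit.
Variable N : lmodType B.
(** Evaluation at u itself, which is [row_gen 1]. *)
Definition row_counit (f : cornerm_of (hom_mod_of N row_action) uu) : N :=
  hom_fun (val f) (phi (row_gen 1)).
Lemma row_counit_linear : linear row_counit.
Proof.
move=> b f g; rewrite /row_counit /=; congr (_ + _).
(* Both sides are values of f, at ub and at bu, and these are equal to b. *)
rewrite /hom_scale_fun -!linearZ /= /row_ract phiK; congr (hom_fun _ (phi _)).
by apply: val_inj; rewrite /= !mulr1 corner_el -[LHS](corner_er b).
Qed.
HB.instance Definition _ :=
  GRing.isLinear.Build B _ N *:%R row_counit row_counit_linear.
End EvalUnit.

(** * Full idempotents: AuA = A *)

Section Full.
Variable l : seq (A * A).
Hypothesis l1 : 1 = \sum_(p <- l) p.1 * u * p.2.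

(** Insert the expression of 1 to the right of x: the summand is (x p.1 u)(u p.2), with first factor
    in B. So the u p.2 generate uA over B. *)
Lemma row_span (x : E) :
  x = \sum_(p <- l) row_coord (row_mulr x p.1) *: row_gen p.2.
Proof.
apply: val_inj; rewrite raddf_sum /= -[LHS]mulr1 l1 [LHS]mulr_sumr.
apply: eq_bigr => p _; rewrite [RHS]/GRing.scale /= -{1}(row_ul x) !mulrA.
by rewrite -(mulrA _ u u) uu.
Qed.

Lemma hom_row_span (N : lmodType B) (f : {linear P -> N}) (y : P) :
  f y = \sum_(p <- l) row_coord (row_mulr (psi y) p.1) *: f (phi (row_gen p.2)).
Proof.
rewrite -{1}(psiK y) {1}(row_span (psi y)) !linear_sum /=.
by apply: eq_bigr => p _; rewrite !linearZ.
Qed.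

(** By [hom_row_span], f is determined by its values at the u p.2, and their coefficients at y are
    those of [p.1 *: row_hom _]. Hence [row_hom] hits generators of Hom_B(P, N). *)
Lemma hom_span (N : lmodType B) (f : hom_mod_of N row_action) :
  f = \sum_(p <- l) p.1 *: row_hom (hom_fun f (phi (row_gen p.2))).
Proof.
apply: linear_ext => y.
rewrite [RHS](big_morph (fun g : hom_mod_of N row_action => hom_fun g y)
  (fun _ _ => erefl) erefl) [LHS]hom_row_span.
by apply: eq_bigr => p _; rewrite [RHS]row_homE /row_ract phiK.
Qed.

Lemma row_hom_fg (N : lmodType B) : fin_gen N -> fin_gen (hom_mod_of N row_action).
Proof.
case=> g gP; apply: (@fin_gen_map _ _ _ g (@row_hom N)) => f.
have /choice[c cP] := gP.
(* Each value f(u p.2) is expanded in the generators [g] with coefficients [c], and [p.1] is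
   multiplied in front. *)
exists (fun i => \sum_(p <- l) p.1 * val (c (hom_fun f (phi (row_gen p.2))) i)).
under [RHS]eq_bigr do rewrite scaler_suml.
rewrite exchange_big {1}(hom_span f); apply: eq_bigr => p _ /=.
rewrite {1}[hom_fun f _]cP row_hom_sum scaler_sumr.
by apply: eq_bigr => i _; rewrite scalerA.
Qed.

(** On the image of m this gives the sum of the p.1 u p.2 m, which is m. *)
Definition row_unit_inv (M : lmodType A)
    (f : hom_mod_of (cornerm_of M uu : lmodType B) row_action) : M :=
  \sum_(p <- l) p.1 *: val (hom_fun f (phi (row_gen p.2))).

Lemma row_unitK (M : lmodType A) : cancel (@row_unit M) (@row_unit_inv M).
Proof.
move=> m; rewrite -[RHS]scale1r l1 scaler_suml; apply: eq_bigr => p _.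
by rewrite /= phiK /= scalerA mulrA.
Qed.

Lemma row_unit_invK (M : lmodType A) : cancel (@row_unit_inv M) (@row_unit M).
Proof.
move=> f; apply: linear_ext => y; apply: val_inj.
rewrite [in RHS](hom_row_span (hom_fun f)) [RHS]raddf_sum [LHS]scaler_sumr.
(* The value of f lies in uM, so a factor u can be inserted in front of it; it turns x p.1 into its
   [row_coord]. *)
apply: eq_bigr => p _ /=; rewrite scalerA -[in LHS](eqP (valP (hom_fun f _))).
by rewrite scalerA; congr (_ *: _); rewrite [u * _]mulrA row_ul.
Qed.

Definition row_counit_inv (N : lmodType B) (y : N) :
    cornerm_of (hom_mod_of N row_action) uu :=
  CornerM uu (introT eqP (row_hom_corner y)).

(** An f with uf = f satisfies f(x) = f(xu) = (xu)f(u), so its value at u determines it. *)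
Lemma row_counitK (N : lmodType B) : cancel (@row_counit N) (@row_counit_inv N).
Proof.
move=> f; apply: val_inj; apply: linear_ext => y.
rewrite [LHS]row_homE /row_counit -!linearZ -[in RHS](eqP (valP f)) /= /hom_scale_fun.
congr (hom_fun _ (phi _)).
by apply: val_inj; rewrite /= mulr1 (row_ul (psi y)) -[LHS]mulrA uu.
Qed.

Lemma row_counit_invK (N : lmodType B) : cancel (@row_counit_inv N) (@row_counit N).
Proof.
move=> y; rewrite /row_counit /= /row_hom_fun phiK -[RHS]scale1r.
by congr (_ *: _); apply: val_inj; rewrite /= mulr1 !uu.
Qed.

Hypothesis fgM : forall M : lmodType A, fin_gen M -> fin_gen (cornerm_of M uu).
Local Notation F := (cornerF fgM : functor (modcat A) (modcat B)).
Local Notation G := (homF row_hom_fg).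

Definition row_unit_hom (M : modcat A) : Defs.hom M (functor_comp G F M) :=
  GRing.Linear.clone _ _ _ _ (@row_unit M) _.
Lemma row_unit_natural (M M' : modcat A) (f : Defs.hom M M') :
  Defs.comp (row_unit_hom M') (fmap (functor_id _) f) =
  Defs.comp (fmap (functor_comp G F) f) (row_unit_hom M).
Proof.
apply: linear_ext => m; apply: linear_ext => p; apply: val_inj.
by rewrite /= linearZ.
Qed.
Definition row_adj_unit : nat_trans (functor_id _) (functor_comp G F) :=
  NatTrans row_unit_natural.

Definition row_counit_hom (N : modcat B) : Defs.hom (functor_comp F G N) N :=
  GRing.Linear.clone _ _ _ _ (@row_counit N) _.
Lemma row_counit_natural (N N' : modcat B) (f : Defs.hom N N') :
  Defs.comp (row_counit_hom N') (fmap (functor_comp F G) f) =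
  Defs.comp (fmap (functor_id _) f) (row_counit_hom N).
Proof. exact: linear_ext. Qed.
Definition row_adj_counit : nat_trans (functor_comp F G) (functor_id _) :=
  @NatTrans _ _ (functor_comp F G) (functor_id _) row_counit_hom row_counit_natural.

Lemma row_triangle1 (M : modcat A) :
  Defs.comp (row_adj_counit (F M)) (fmap F (row_adj_unit M)) = idm (F M).
Proof.
apply: linear_ext => m; apply: val_inj.
by rewrite /= /row_counit /= phiK /= mulr1; apply/eqP/(valP m).
Qed.

Lemma row_triangle2 (N : modcat B) :
  Defs.comp (fmap G (row_adj_counit N)) (row_adj_unit (G N)) = idm (G N).
Proof.
apply: linear_ext => f; apply: linear_ext => p.
rewrite /= /row_counit /= /hom_scale_fun /= /row_ract phiK.
rewrite -[in RHS](psiK p); congr (hom_fun f (phi _)); apply: val_inj.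
by rewrite /= mulr1 row_ul.
Qed.

(** Unit and counit are bijective at each module, and bijective linear maps are isomorphisms. *)
Lemma row_inverse_right_adjoint : inverse_right_adjoint F G.
Proof.
exists (Adjunction row_triangle1 row_triangle2).
split=> [M|N]; apply: bijective_is_iso.
- exact: row_unitK.
- exact: row_unit_invK.
- exact: row_counitK.
- exact: row_counit_invK.
Qed.

End Full.
End Action.
End CornerHom.

(** * Projectivity of direct sums of left ideals Af_i *)

Section IdempotentSum.
Variables (A : pzRingType) (I : finType) (f : I -> A).
Hypothesis ff : forall i, f i * f i = f i.
Local Notation P := (dsum (fun i => left_ideal (f i))).

Lemma dsum_sumE J (r : seq J) (y : J -> P) i :
  (\sum_(j <- r) y j) i = \sum_(j <- r) y j i.
Proof. exact: (big_morph (fun z : P => z i)). Qed.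

Definition dsum_gen (i : I) : P :=
  dfwith (0 : P) (LeftIdeal (introT eqP (ff i)) : left_ideal (f i)).

Lemma dsum_span (y : P) : y = \sum_i val (y i) *: dsum_gen i.
Proof.
apply: functional_extensionality_dep => j; rewrite dsum_sumE (bigD1 j) //=.
rewrite [X in _ + X]big1 ?addr0 => [|i ij].
  apply: val_inj; rewrite -[RHS]/(val (y j) * val (dsum_gen j j)) /dsum_gen dfwith_in.
  by apply/esym/eqP/(valP (y j)).
by rewrite -[LHS]/(val (y i) *: dsum_gen i j) /dsum_gen dfwith_out // scaler0.
Qed.

(** The entry y_i, being equal to y_i f_i, is a coefficient of y that depends linearly on y. So a
    lift is fixed by choosing preimages [x] of the images of the generators. *)
Lemma dsum_projective : projective (P : lmodType A).
Proof.
move=> M N g h gS; have /choice[x xP] := fun i => gS (h (dsum_gen i)).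
pose H (y : P) : M := \sum_i val (y i) *: x i.
have HL : linear H.
  move=> a y z; rewrite /H scaler_sumr -big_split; apply: eq_bigr => i _ /=.
  by rewrite scalerA -scalerDl.
pose H' : {linear P -> M} := HB.pack H (GRing.isLinear.Build A P M *:%R H HL).
exists H' => y /=.
rewrite linear_sum [in RHS](dsum_span y) linear_sum; apply: eq_bigr => i _.
by rewrite !linearZ xP.
Qed.
End IdempotentSum.

(** * Vertex idempotents under breaking and the multiplicities M_uv *)

Section Breaking.
Variables (k : comNzRingType) (A : kalg k) (n : nat) (e : 'I_n -> A).
Hypothesis eP : complete_orthogonal e.
Implicit Types (s : seq (bstep A n)) (x : bstep A n).

Section Step.
Variables (s : seq (bstep A n)) (x : bstep A n).
Hypothesis hxs : is_breaking e (x :: s).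
Local Notation f := (sg_vertex (broken e s)).
Local Notation f' := (sg_vertex (broken e (x :: s))).
Local Notation t := (st_tl x).
Local Notation h := (st_hd x).
Local Notation a := (sg_br (broken e s) (st_el x)).
Local Notation ar := (sg_br (broken e s) (st_sec x)).

Let hs : is_breaking e s. Proof. by case: hxs. Qed.
Let BP := brokenP eP hs.

Lemma step_elE : a = f h * st_el x * f t.
Proof. by case: hxs => _ ab _ _; rewrite (inv_block eP BP ab). Qed.
Lemma step_secE : ar = f t * st_sec x * f h.
Proof. by case: hxs => _ _ ab _; rewrite (inv_block eP BP ab). Qed.
Lemma step_el_tl : a * f t = a.
Proof. by rewrite step_elE -!mulrA (inv_idem BP). Qed.
Lemma step_el_hd : f h * a = a.
Proof. by rewrite step_elE !mulrA (inv_idem BP). Qed.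
Lemma step_sec_tl : f t * ar = ar.
Proof. by rewrite step_secE !mulrA (inv_idem BP). Qed.
Lemma step_sec_hd : ar * f h = ar.
Proof. by rewrite step_secE -!mulrA (inv_idem BP). Qed.
Lemma step_el_sec : a * ar = f h.
Proof. by case: hxs => _ _ _ []. Qed.

Lemma step_vertex v : f' v = f v - (v == t)%:R * (ar * a).
Proof. by rewrite /=; case: eqP => _; rewrite ?mul1r // mul0r subr0. Qed.
Lemma step_vertex_tl : f' t = f t - ar * a.
Proof. by rewrite step_vertex eqxx mul1r. Qed.
Lemma step_vertex_hd : f' h = f h.
Proof. by case: hxs => _ _ _ [] th *; rewrite step_vertex eq_sym (negPf th) mul0r subr0. Qed.

(** Since a a^r a = e_h a = a. With [step_sec0] this separates the two parts f'_t and a^r a of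
    f_t. *)
Lemma step_el0 : a * f' t = 0.
Proof. by rewrite step_vertex_tl mulrBr step_el_tl mulrA step_el_sec step_el_hd subrr. Qed.
Lemma step_sec0 : f' t * ar = 0.
Proof.
by rewrite step_vertex_tl mulrBl step_sec_tl -mulrA step_el_sec step_sec_hd subrr.
Qed.
Lemma step_vertex_l v : f v * f' v = f' v.
Proof.
have [->|vt] := eqVneq v t; last first.
  by rewrite step_vertex (negPf vt) mul0r subr0 (inv_idem BP).
by rewrite step_vertex_tl mulrBr (inv_idem BP) mulrA step_sec_tl.
Qed.
Lemma step_vertex_r v : f' v * f v = f' v.
Proof.
have [->|vt] := eqVneq v t; last first.
  by rewrite step_vertex (negPf vt) mul0r subr0 (inv_idem BP).
by rewrite step_vertex_tl mulrBl (inv_idem BP) -mulrA step_el_tl.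
Qed.
End Step.

(** Right multiplication by the elementary matrix adds column t to column h. This mirrors the
    splitting of Af_t into Af'_t and Aa^r a, the latter isomorphic to Af_h. *)
Lemma break_mx_cons x s u v :
  break_mx (x :: s) u v = (break_mx s u v + break_mx s u (st_tl x) * (v == st_hd x))%N.
Proof.
rewrite /= /elem_mx mulmxDr mulmx1 mxE; congr (_ + _)%N.
rewrite mxE (bigD1 (st_tl x)) //= big1 ?addr0 => [|w wt]; last first.
  by rewrite mxE (negPf wt) mulr0.
by rewrite mxE eqxx /=; case: (_ == _).
Qed.

(* U i only indexes the copies in P: al i is not required to lie in e (U i) * A. *)
Record vertex_family s (I : finType) (U V : I -> 'I_n) (al be : I -> A) : Prop :=
  VertexFamily {
    vf_count : forall u v,
      (\sum_(i | (U i == u) && (V i == v)) 1)%N = break_mx s u v;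
    vf_l : forall i, al i * sg_vertex (broken e s) (V i) = al i;
    vf_r : forall i, sg_vertex (broken e s) (V i) * be i = be i;
    vf_idem : forall i, be i * al i = sg_vertex (broken e s) (V i);
    vf_orth : forall i j, i != j -> be i * al j = 0;
    vf_sum : \sum_i al i * be i = 1
  }.

(** Every copy i stays at its vertex with the smaller idempotent ([inl]). A copy at t also yields a
    new one at h ([inr]), for the split-off part a^r a, carried to e_h by a and a^r. *)
Lemma vertex_family_step s x I U V al be :
    is_breaking e (x :: s) -> @vertex_family s I U V al be ->
  let J := {i | i \in [pred i | V i == st_tl x]} in
  let f' := sg_vertex (broken e (x :: s)) in
  @vertex_family (x :: s) (I + J : finType)%type
    (fun i => match i with inl i => U i | inr j => U (val j) end)
    (fun i => match i with inl i => V i | inr j => st_hd x end)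
    (fun i => match i with inl i => al i * f' (V i)
      | inr j => al (val j) * sg_br (broken e s) (st_sec x) end)
    (fun i => match i with inl i => f' (V i) * be i
      | inr j => sg_br (broken e s) (st_el x) * be (val j) end).
Proof.
move=> hxs vf J f'; have hs : is_breaking e s by case: hxs.
have BP := brokenP eP hs; have BP' := brokenP eP hxs.
have VJ (j : J) : V (val j) = st_tl x by apply/eqP/(valP j).
split.
- move=> u v; rewrite break_mx_cons -!(vf_count vf) big_sumType /=; congr (_ + _)%N.
  rewrite eq_sym; case: eqP => _ /=; last by rewrite muln0 big_pred0 // => i; rewrite andbF.
  rewrite muln1; transitivity (\sum_(i in [pred i | V i == st_tl x] | U i == u) 1)%N.
    by rewrite [RHS]big_sub_cond; apply: eq_bigl => i; rewrite andbT.
  by apply: eq_bigl => i; rewrite andbC.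
- case=> [i|j]; first by rewrite -mulrA (inv_idem BP').
  by rewrite -mulrA step_vertex_hd // step_sec_hd.
- case=> [i|j]; first by rewrite mulrA (inv_idem BP').
  by rewrite mulrA step_vertex_hd // step_el_hd.
- case=> [i|j].
    by rewrite mulrA -(mulrA _ (be i)) (vf_idem vf) step_vertex_r // (inv_idem BP').
  rewrite mulrA -(mulrA _ (be _)) (vf_idem vf) VJ step_el_tl // step_el_sec //.
  by rewrite step_vertex_hd.
(* The two copies made from one i meet in f'_t a^r or a f'_t, which vanish; all other pairs are
   orthogonal already. *)
- case=> [i|i] [j|j] ij.
  + by rewrite mulrA -(mulrA _ (be i)) (vf_orth vf) // mulr0 mul0r.
  + rewrite mulrA -(mulrA _ (be i)); have [->|ij'] := eqVneq i (val j).
      by rewrite (vf_idem vf) step_vertex_r // VJ step_sec0.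
    by rewrite (vf_orth vf) // mulr0 mul0r.
  + rewrite mulrA -(mulrA _ (be _)); have [<-|ij'] := eqVneq (val i) j.
      by rewrite (vf_idem vf) VJ step_el_tl // step_el0.
    by rewrite (vf_orth vf) // mulr0 mul0r.
  + by rewrite mulrA -(mulrA _ (be _)) (vf_orth vf) // mulr0 mul0r.
(* The sum over [J] becomes a conditional sum over [I]; then the terms of each i add up through f_t
   = f'_t + a^r a. *)
- rewrite big_sumType /= -(big_sub _ (fun i => al i * sg_br (broken e s) (st_sec x) *
    (sg_br (broken e s) (st_el x) * be i))) /=.
  rewrite (big_mkcond (fun i => i \in _)) -big_split -(vf_sum vf).
  apply: eq_bigr => i _ /=; rewrite mulrA -(mulrA (al i) (f' _)) (inv_idem BP').
  rewrite -[in RHS](vf_l vf i) /f' step_vertex inE; case: eqP => _.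
    by rewrite mul1r mulrBr mulrBl !mulrA subrK.
  by rewrite mul0r subr0 addr0.
Qed.

Lemma vertex_family_exists s : is_breaking e s ->
  exists I U V al be, @vertex_family s I U V al be.
Proof.
elim: s => [_|x s IH hxs]; last first.
  have hs : is_breaking e s by case: hxs.
  have [I [U [V [al [be vf]]]]] := IH hs.
  by do 5!eexists; apply: vertex_family_step hxs vf.
(* Before any breaking the family is one copy of each vertex, counted by the identity matrix. *)
case: eP => ei eo e1; exists 'I_n, id, id, e, e; split=> //=; last by rewrite -e1; apply: eq_bigr.
move=> u v; rewrite mxE; case: (eqVneq u v) => [->|uv] /=.
  by rewrite (big_pred1 v) // => i; rewrite andbb.
by rewrite big_pred0 // => i; case: (eqVneq i u) => [->|] //=; apply: negbTE.
Qed.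

(** * The isomorphism of P with e'A and the Morita equivalence *)

Section Proj.
Variables (s : seq (bstep A n)) (hs : is_breaking e s).
Local Notation B := (br_alg eP hs).
Local Notation E := (br_mod eP hs (A^o : lmodType A)).
Local Notation P := (br_proj eP hs).
Local Notation J := {uv : 'I_n * 'I_n & 'I_(break_mx s uv.1 uv.2)}.

(** The fibre of (U, V) over (u, v) has M_uv elements, so enumerating the fibres gives a bijection
    [g] from the index set of P to [I], along which the family is transported. *)
Lemma vertex_family_tag : exists al be, @vertex_family s J (fun i => (tag i).1)
  (fun i => (tag i).2) al be.
Proof.
have [I [U [V [al [be vf]]]]] := vertex_family_exists hs.
pose S (uv : 'I_n * 'I_n) := [pred i | (U i == uv.1) && (V i == uv.2)].
have SM uv : break_mx s uv.1 uv.2 = #|S uv|.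
  by rewrite -(vf_count vf) sum1_card.
pose g (i : J) : I := enum_val (cast_ord (SM (tag i)) (tagged i)).
have gS i : (U (g i) = (tag i).1) * (V (g i) = (tag i).2).
  by have /andP[/eqP-> /eqP->] := enum_valP (cast_ord (SM (tag i)) (tagged i)).
have g_inj : injective g.
  move=> i j gij; have tij : tag i = tag j.
    by apply/eqP; rewrite -pair_eqE /= -!gS gij !eqxx.
  case: i j tij gij {gS} => [uv i] [uv' j] /= tij; subst uv'.
  by move/enum_val_inj/cast_ord_inj => /= ->.
have g_surj i : exists j, g j = i.
  have iS : i \in S (U i, V i) by rewrite inE !eqxx.
  exists (Tagged (fun uv => 'I_(break_mx s uv.1 uv.2))
    (cast_ord (esym (SM (U i, V i))) (enum_rank_in iS i))).
  by rewrite /g /= cast_ordKV enum_rankK_in.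
have /choice[g' g'K] := g_surj.
have gK : cancel g g' by move=> i; apply: g_inj; rewrite g'K.
exists (al \o g), (be \o g); split=> [u v|i|i|i|i j ij|] /=.
- rewrite -(vf_count vf) [RHS](reindex g) /=; last by exists g' => i _.
  by apply: eq_bigl => i; rewrite !gS.
- by rewrite -gS (vf_l vf).
- by rewrite -gS (vf_r vf).
- by rewrite -gS (vf_idem vf).
- by rewrite (vf_orth vf) // (inj_eq g_inj).
- by rewrite -(vf_sum vf) [RHS](reindex g) //; exists g' => i _.
Qed.

(** The maps are x |-> (x alpha_i) and y |-> sum of the y_i beta_i. One composite is the identity by
    sum alpha_i beta_i = 1, the other by the orthogonality relations. *)
Lemma br_proj_iso :
  exists (phi : {linear E -> P}) (psi : {linear P -> E}), cancel phi psi /\ cancel psi phi.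
Proof.
have BP := brokenP eP hs; have uu := inv_uu BP.
have [al [be vf]] := vertex_family_tag.
set u := sg_unit (broken e s) in uu.
pose f := sg_vertex (broken e s).
have phi1 (x : E) (i : J) : corner_pred u (val x * al i : A).
  rewrite /corner_pred mulrA row_ul -mulrA -(vf_l vf) -!mulrA (inv_ur BP).
  by rewrite eqxx.
have phi2 (x : E) i : left_ideal_pred (br_vertex eP hs (tag i).2)
    (Corner (broken_unit_idem eP hs) (phi1 x i)).
  by apply/eqP/val_inj; rewrite /= -mulrA (vf_l vf).
pose phi (x : E) : P := fun i => LeftIdeal (phi2 x i).
have phiL : linear phi.
  move=> b x y; apply: functional_extensionality_dep => i; do 2!apply: val_inj.
  by rewrite /= mulrDl -mulrA.
pose psi0 (y : P) : A := \sum_i val (val (y i)) * be i.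
have psi1 y : cornerm_pred u (psi0 y : A^o).
  apply/eqP; rewrite [LHS]mulr_sumr; apply: eq_bigr => i _.
  by rewrite mulrA corner_el.
pose psi (y : P) : E := CornerM (broken_unit_idem eP hs) (psi1 y).
have phiK : cancel phi psi.
  move=> x; apply: val_inj; rewrite /= /psi0 -[RHS]mulr1 -(vf_sum vf) [RHS]mulr_sumr.
  by apply: eq_bigr => i _; rewrite [RHS]mulrA.
have psiK : cancel psi phi.
  move=> y; apply: functional_extensionality_dep => i; do 2!apply: val_inj.
  rewrite /= /psi0 mulr_suml (bigD1 i) //= -mulrA (vf_idem vf) big1 ?addr0 => [|j ji].
    by have /eqP/(congr1 val) := valP (y i).
  by rewrite -mulrA (vf_orth vf) ?mulr0.
pose phi' : {linear E -> P} := HB.pack phi (GRing.isLinear.Build B E P *:%R phi phiL).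
have psiL : linear psi := can2_linear (f := phi') phiK psiK.
pose psi' : {linear P -> E} := HB.pack psi (GRing.isLinear.Build B P E *:%R psi psiL).
by exists phi', psi'.
Qed.

Lemma br_proj_projective : projective P.
Proof.
apply: dsum_projective => i; apply: val_inj; exact: (inv_idem (brokenP eP hs)).
Qed.

Lemma br_inverse_right_adjoint : exists (r : right_action A P)
  (fgP : forall N : lmodType B, fin_gen N -> fin_gen (hom_mod_of N r)),
  inverse_right_adjoint (br_functor eP hs) (homF fgP).
Proof.
have [phi [psi [phiK psiK]]] := br_proj_iso.
have [l l1] := broken_full eP hs.
exists (row_action phiK psiK), (row_hom_fg phiK psiK l1).
exact: row_inverse_right_adjoint.
Qed.

Lemma br_morita_equivalent : morita_equivalent B A.
Proof.
have [r [fgP]] := br_inverse_right_adjoint.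
exact: inverse_right_adjoint_equivalent.
Qed.
End Proj.
End Breaking.

(** * Kernels and cokernels at a vertex *)

Section KerCoker.
Variables (k : comNzRingType) (A : kalg k) (n : nat) (e : 'I_n -> A).
Hypothesis eP : complete_orthogonal e.
Implicit Types (s : seq (bstep A n)) (x : bstep A n).

Section Criterion.
Variables (s : seq (bstep A n)) (hs : is_breaking e s).
Variables (M : lmodType A) (v : 'I_n).
Local Notation f := (sg_vertex (broken e s)).
Let BP := brokenP eP hs.

Lemma br_mk_subproof1 (m : M) : cornerm_pred (sg_unit (broken e s)) (f v *: m).
Proof. by apply/eqP; rewrite scalerA (inv_ul BP). Qed.
Lemma br_mk_subproof2 (m : M) : cornerm_pred (M := br_mod eP hs M) (br_vertex eP hs v)
  (CornerM (broken_unit_idem eP hs) (br_mk_subproof1 m)).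
Proof. by apply/eqP/val_inj; rewrite /= scalerA (inv_idem BP). Qed.
(** Br(M)(v) is a subtype of a subtype of M; multiplication by f_v projects M onto it. *)
Definition br_mk (m : M) : br_mod_at eP hs M v := VPart (br_mk_subproof2 m).

Lemma br_mod_val_inj : injective (@br_mod_val _ _ _ _ eP _ hs M v).
Proof. by move=> x y xy; do 2!apply: val_inj. Qed.

Lemma br_mod_valP (x : br_mod_at eP hs M v) : f v *: br_mod_val x = br_mod_val x.
Proof. by have /eqP/(congr1 val) := valP x. Qed.

Definition br_proj_at (m : vpart (e v) M) : br_mod_at eP hs M v := br_mk (val m).
Lemma br_proj_at_linear : linear br_proj_at.
Proof.
move=> c m m'; apply: br_mod_val_inj; rewrite /br_mod_val /= scalerDr !scalerA.
congr (_ *: _ + _).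
by rewrite corner_scalE ?(inv_uu BP) // -mulrA (inv_ul BP) scalC.
Qed.
HB.instance Definition _ := GRing.isLinear.Build k _ _ *:%R br_proj_at br_proj_at_linear.

Lemma sum_st_from (V : nmodType) (F : 'I_(size s) -> V) :
  \sum_(i : st_from s v) F (val i) = \sum_(i | st_tl (st_at i) == v) F i.
Proof. by rewrite -(big_sub [pred i | st_tl (st_at i) == v]). Qed.


Lemma el_act0 (al : 'I_(size s) -> A) (i : st_from s v) (m : vpart (e v) M) :
  el_act eP al i m = 0 <-> (e (st_hd (st_at (val i))) * al (val i)) *: val m = 0.
Proof.
by rewrite -scalerA; split=> [/(congr1 val)|] h //; apply: val_inj.
Qed.

Lemma sec_sumE (be : 'I_(size s) -> A)
    (y : dsum (fun i : st_from s v => vpart (e (st_hd (st_at (val i)))) M)) :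
  val (sec_sum eP be y) = \sum_i (e v * be (val i)) *: val (y i).
Proof. by rewrite raddf_sum; apply: eq_bigr => i _ /=; rewrite scalerA. Qed.

(** The first two conditions put f_v M into every kernel and make f_v vanish on the images of the
    [be i]. By the third, e_v - f_v kills the common kernel; by the fourth, it maps M(v) into the
    sum of these images. The coefficients [d] and [c] stand on opposite sides. *)
Lemma ker_coker_criterion (al be d c : 'I_(size s) -> A) :
    (forall i, st_tl (st_at i) = v -> e (st_hd (st_at i)) * al i * f v = 0) ->
    (forall i, st_tl (st_at i) = v -> f v * be i = 0) ->
    e v - f v =
      \sum_(i | st_tl (st_at i) == v) d i * (e (st_hd (st_at i)) * al i) ->
    e v - f v =
      \sum_(i | st_tl (st_at i) == v) be i * (e (st_hd (st_at i)) * c i) ->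
  is_ker_coker eP hs M v al be.
Proof.
have [ei _ _] := eP; move=> al0 be0 dal cbe; split.
  move=> m; split=> [[x <-]|[m' <- m'0]].
    have xv : cornerm_pred (e v) (br_mod_val x).
      by apply/eqP; rewrite -(br_mod_valP x) scalerA (inv_l BP).
    exists (VPart xv) => // i; apply/el_act0.
    by rewrite /= -(br_mod_valP x) scalerA al0 ?scale0r //; apply/eqP/(valP i).
  exists (br_mk (val m')); apply/esym/eqP; rewrite -subr_eq0.
  rewrite -[X in X - _](eqP (valP m')) -scalerBl dal -sum_st_from scaler_suml.
  by rewrite big1 // => i _; rewrite -scalerA (el_act0 _ _ _).1 ?scaler0.
exists br_proj_at; split; last first.
  by move=> m x xm; apply: br_mod_val_inj; rewrite -[RHS]br_mod_valP xm.
split=> [x|m]; last split=> [/(congr1 (@br_mod_val _ _ _ _ eP _ hs M v)) fm|[y ->]].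
- have xv : cornerm_pred (e v) (br_mod_val x).
    by apply/eqP; rewrite -(br_mod_valP x) scalerA (inv_l BP).
  by exists (VPart xv); apply: br_mod_val_inj; rewrite -[RHS]br_mod_valP.
- have yP (i : st_from s v) : cornerm_pred (e (st_hd (st_at (val i))))
      ((e (st_hd (st_at (val i))) * c (val i)) *: val m).
    (* If f_v m = 0 then m = (e_v - f_v)m, so the fourth condition provides the preimage with
       entries e_h c_i m. *)
    by apply/eqP; rewrite scalerA mulrA ei.
  exists (fun i => VPart (yP i)); apply: val_inj; rewrite sec_sumE.
  have fm0 : f v *: val m = 0 by exact: fm.
  transitivity ((e v * (e v - f v)) *: val m).
    by rewrite mulrBr (inv_l BP) ei scalerBl fm0 subr0 (eqP (valP m)).
  rewrite cbe mulr_sumr scaler_suml -sum_st_from.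
  by apply: eq_bigr => i _; rewrite scalerA !mulrA.
- apply: br_mod_val_inj; rewrite -[LHS]/(f v *: val _) sec_sumE scaler_sumr big1 // => i _.
  by rewrite scalerA mulrA (inv_r BP) be0 ?scale0r //; apply/eqP/(valP i).
Qed.
End Criterion.

Lemma drop_st_at s (i : 'I_(size s)) : drop i s = st_at i :: drop i.+1 s.
Proof. by rewrite (drop_nth (st_at i)) // {2}/st_at (tnth_nth (st_at i)). Qed.

Lemma st_at_lift x s (i : 'I_(size s)) :
  st_at (lift ord0 i : 'I_(size (x :: s))) = st_at i.
Proof. by rewrite /st_at !(tnth_nth x). Qed.

Lemma big_st_at_cons x s v (F : 'I_(size (x :: s)) -> A) :
  \sum_(i | st_tl (st_at i) == v) F i =
  (if st_tl x == v then F ord0 else 0) +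
  \sum_(i | st_tl (st_at i) == v) F (lift ord0 i).
Proof.
rewrite big_mkcond big_ord_recl [in RHS]big_mkcond; congr (_ + _).
by apply: eq_bigr => i _; rewrite st_at_lift.
Qed.

Lemma is_breaking_drop s m : is_breaking e s -> is_breaking e (drop m s).
Proof. by elim: s m => [|x s IH] [|m] //= [hs _ _ _]; apply: IH. Qed.

(** This makes the lemmas on a single step available at every position. *)
Lemma is_breaking_at s (i : 'I_(size s)) :
  is_breaking e s -> is_breaking e (st_at i :: drop i.+1 s).
Proof. by rewrite -drop_st_at; apply: is_breaking_drop. Qed.

(** [drop m s] is an earlier stage, and every step only shrinks a vertex idempotent. So whatever
    kills the idempotent of an intermediate stage also kills the final one. *)
Lemma vertex_drop_l s m v : is_breaking e s ->
  sg_vertex (broken e (drop m s)) v * sg_vertex (broken e s) v =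
  sg_vertex (broken e s) v.
Proof.
elim: s m => [|x s IH] [|m] hs; try exact: inv_idem (brokenP eP hs) v.
by rewrite -(step_vertex_l eP hs) mulrA IH //; case: hs.
Qed.

Lemma vertex_drop_r s m v : is_breaking e s ->
  sg_vertex (broken e s) v * sg_vertex (broken e (drop m s)) v =
  sg_vertex (broken e s) v.
Proof.
elim: s m => [|x s IH] [|m] hs; try exact: inv_idem (brokenP eP hs) v.
by rewrite -(step_vertex_r eP hs) -mulrA IH //; case: hs.
Qed.

Lemma vertex_unbroken s w :
  all (fun x => st_tl x != w) s -> sg_vertex (broken e s) w = e w.
Proof. by elim: s => //= x s IH /andP[xw /IH ->]; rewrite eq_sym (negPf xw). Qed.

Section At.
Variables (s : seq (bstep A n)) (hs : is_breaking e s) (i : 'I_(size s)).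
Local Notation t := (st_tl (st_at i)).
Local Notation h := (st_hd (st_at i)).
Let hi := is_breaking_at i hs.

(** The element broken at position i kills f_t right after its own step, at the stage [drop i s]. *)
Lemma br_el_vertex : br_el e i * sg_vertex (broken e s) t = 0.
Proof. by rewrite -(vertex_drop_l i) // drop_st_at mulrA step_el0 // mul0r. Qed.

Lemma vertex_br_sec : sg_vertex (broken e s) t * br_sec e i = 0.
Proof. by rewrite -(vertex_drop_r i) // drop_st_at -mulrA step_sec0 // mulr0. Qed.

Lemma br_el_hd : e h * br_el e i = br_el e i.
Proof.
have BP : stage_inv e (broken e (drop i.+1 s)) by apply: brokenP => //; case: hi.
by rewrite /br_el (step_elE eP hi) !mulrA (inv_l BP).
Qed.

Lemma st_el_hd : e h * st_el (st_at i) = st_el (st_at i).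
Proof. by have [ei _ _] := eP; case: hi => _ <- _ _; rewrite !mulrA ei. Qed.

Section Unbroken.
Hypothesis hu : heads_unbroken s t.

Lemma head_unbroken : sg_vertex (broken e (drop i.+1 s)) h = e h.
Proof.
apply: vertex_unbroken; apply/(all_nthP (st_at i)) => j; rewrite size_drop => ji.
have jP : (i.+1 + j < size s)%N by rewrite -ltn_subRL.
have -> : nth (st_at i) (drop i.+1 s) j = st_at (Ordinal jP).
  by rewrite nth_drop [RHS](tnth_nth (st_at i)).
by apply: hu => //=; rewrite ltn_addr.
Qed.

(** In f_h a_i f_t the left factor is still e_h, which a_i absorbs. *)
Lemma br_el_unbroken :
  br_el e i = st_el (st_at i) * sg_vertex (broken e (drop i.+1 s)) t.
Proof. by rewrite /br_el (step_elE eP hi) head_unbroken st_el_hd. Qed.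

Lemma br_sec_unbroken :
  br_sec e i = sg_vertex (broken e (drop i.+1 s)) t * st_sec (st_at i).
Proof.
have [ei _ _] := eP; rewrite /br_sec (step_secE eP hi) head_unbroken.
by case: hi => _ _ <- _; rewrite -!mulrA ei.
Qed.

Lemma st_el_vertex : st_el (st_at i) * sg_vertex (broken e s) t = 0.
Proof. by rewrite -(vertex_drop_l i.+1) // mulrA -br_el_unbroken br_el_vertex. Qed.

Lemma vertex_st_sec : sg_vertex (broken e s) t * st_sec (st_at i) = 0.
Proof. by rewrite -(vertex_drop_r i.+1) // -mulrA -br_sec_unbroken vertex_br_sec. Qed.
End Unbroken.
End At.

Lemma heads_unbroken_behead x s v : heads_unbroken (x :: s) v -> heads_unbroken s v.
Proof.
move=> hu i j iv ij; rewrite -(st_at_lift x) -(st_at_lift x i); apply: hu => //.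
by rewrite st_at_lift.
Qed.

(** Telescoping: a step with tail v subtracts a^r a from f_v, and the other steps keep f_v. *)
Lemma vertex_defect s v : is_breaking e s ->
  e v - sg_vertex (broken e s) v =
  \sum_(i : 'I_(size s) | st_tl (st_at i) == v) br_sec e i * br_el e i.
Proof.
elim: s => [_|x s IH hxs]; first by rewrite subrr big_ord0.
have hs : is_breaking e s by case: hxs.
rewrite step_vertex big_st_at_cons opprB addrCA (IH hs) eq_sym; congr (_ + _).
  rewrite /br_sec /br_el /= drop0.
  by case: eqP => _; rewrite ?mul1r // mul0r.
by apply: eq_bigr => i _; rewrite /br_sec /br_el st_at_lift.
Qed.

Lemma br_el_head x s :
  br_el e (ord0 : 'I_(size (x :: s))) = sg_br (broken e s) (st_el x).
Proof. by rewrite /br_el /= drop0. Qed.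

Lemma br_sec_head x s :
  br_sec e (ord0 : 'I_(size (x :: s))) = sg_br (broken e s) (st_sec x).
Proof. by rewrite /br_sec /= drop0. Qed.

(* Here br_el i = st_el i * f with f the vertex idempotent at v before step i:
   expanding f = e v - (e v - f) by induction removes f from vertex_defect. *)
Lemma vertex_defect_el s v : is_breaking e s -> heads_unbroken s v ->
  exists d : nat -> A, e v - sg_vertex (broken e s) v =
  \sum_(i : 'I_(size s) | st_tl (st_at i) == v) d i * st_el (st_at i).
Proof.
have [ei _ _] := eP.
elim: s => [_|x s IH hxs] hu; first by exists (fun=> 0); rewrite subrr big_ord0.
have hs : is_breaking e s by case: hxs.
have [d dE] := IH hs (heads_unbroken_behead hu).
set ar := sg_br (broken e s) (st_sec x).
have [tv|tv] := eqVneq (st_tl x) v; last first.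
  (* Position 0 is excluded by its tail, so [d] is only shifted; a domain [nat] makes the shift a
     predecessor. *)
  exists (fun m => d m.-1); rewrite big_st_at_cons (negPf tv) add0r.
  rewrite step_vertex eq_sym (negPf tv) mul0r subr0 dE.
  by apply: eq_bigr => i _; rewrite st_at_lift.
(* From [aE], a^r a is [ar * st_el x] minus [ar * st_el x * (e v - f)], f being the idempotent at v
   before the step. Expanding e v - f by [dE] corrects the older coefficients. *)
exists (fun m => if m is m'.+1 then d m' - ar * st_el x * d m' else ar).
have aE : sg_br (broken e s) (st_el x) =
    st_el x - st_el x * (e v - sg_vertex (broken e s) v).
  have := @br_el_unbroken _ hxs ord0; rewrite br_el_head /= drop0 => ->; last by rewrite tv.
  have el_v : st_el x * e v = st_el x by case: hxs => _ <- _ _; rewrite tv -!mulrA ei.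
  by rewrite mulrBr el_v subKr tv.
rewrite big_st_at_cons tv eqxx -tv step_vertex_tl tv opprB addrCA -/ar aE.
rewrite mulrBr mulrA -addrA; congr (_ + _).
rewrite addrC {1}dE dE mulr_sumr -sumrB; apply: eq_bigr => i _.
by rewrite st_at_lift mulrBl !mulrA.
Qed.

(** The mirror image: here [br_sec i] is f * [st_sec], so f is expanded on the left and the
    coefficients end up on the right, as the cokernel requires. *)
Lemma vertex_defect_sec s v : is_breaking e s -> heads_unbroken s v ->
  exists c : nat -> A, e v - sg_vertex (broken e s) v =
  \sum_(i : 'I_(size s) | st_tl (st_at i) == v) st_sec (st_at i) * c i.
Proof.
have [ei _ _] := eP.
elim: s => [_|x s IH hxs] hu; first by exists (fun=> 0); rewrite subrr big_ord0.
have hs : is_breaking e s by case: hxs.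
have [c cE] := IH hs (heads_unbroken_behead hu).
set a := sg_br (broken e s) (st_el x).
have [tv|tv] := eqVneq (st_tl x) v; last first.
  exists (fun m => c m.-1); rewrite big_st_at_cons (negPf tv) add0r.
  rewrite step_vertex eq_sym (negPf tv) mul0r subr0 cE.
  by apply: eq_bigr => i _; rewrite st_at_lift.
exists (fun m => if m is m'.+1 then c m' - c m' * st_sec x * a else a).
have arE : sg_br (broken e s) (st_sec x) =
    st_sec x - (e v - sg_vertex (broken e s) v) * st_sec x.
  have := @br_sec_unbroken _ hxs ord0; rewrite br_sec_head /= drop0 => ->; last by rewrite tv.
  have sec_v : e v * st_sec x = st_sec x by case: hxs => _ _ <- _; rewrite tv !mulrA ei.
  by rewrite mulrBl sec_v subKr tv.
rewrite big_st_at_cons tv eqxx -tv step_vertex_tl tv opprB addrCA -/a arE.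
rewrite mulrBl -addrA; congr (_ + _).
rewrite addrC {1}cE cE !mulr_suml -sumrB; apply: eq_bigr => i _.
by rewrite st_at_lift mulrBr !mulrA.
Qed.

Section Main.
Variables (s : seq (bstep A n)) (hs : is_breaking e s).
Variables (M : lmodType A) (v : 'I_n).

(** Sections and elements serve as each other's coefficients, so both expansions asked for by the
    criterion are [vertex_defect]. *)
Lemma br_ker_coker : is_ker_coker eP hs M v (br_el e (s := s)) (br_sec e (s := s)).
Proof.
apply: (@ker_coker_criterion _ _ _ _ _ _ (br_sec e (s := s)) (br_el e (s := s))).
- by move=> i <-; rewrite br_el_hd // br_el_vertex.
- by move=> i <-; rewrite vertex_br_sec.
- by rewrite vertex_defect //; apply: eq_bigr => i _; rewrite br_el_hd.
- by rewrite vertex_defect //; apply: eq_bigr => i _; rewrite br_el_hd.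
Qed.

Lemma unbroken_ker_coker : heads_unbroken s v ->
  is_ker_coker eP hs M v (fun i => st_el (st_at i)) (fun i => st_sec (st_at i)).
Proof.
move=> hu; have [ei _ _] := eP.
have [d dE] := vertex_defect_el hs hu; have [c cE] := vertex_defect_sec hs hu.
apply: (@ker_coker_criterion _ _ _ _ _ _ (fun i => d i) (fun i => c i)).
- by move=> i iv; rewrite st_el_hd // -iv st_el_vertex // iv.
- by move=> i iv; rewrite -iv vertex_st_sec // iv.
- by rewrite dE; apply: eq_bigr => i _; rewrite st_el_hd.
- rewrite cE; apply: eq_bigr => i _.
  by have [_ _ <- _] := is_breaking_at i hs; rewrite -!mulrA (mulrA (e _) (e _)) ei.
Qed.
End Main.
End KerCoker.

Theorem theorem1p8 (k : idomainType) (kPID : is_PID k) (n : nat) (Q : qrs k n)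
    (basic : basic_partition (qrs_vertex Q))
    (s : seq (bstep (qrs_alg Q) n)) (hs : is_breaking (qrs_vertex Q) s) :
  let A := qrs_alg Q in
  let eP := qrs_vertexP Q in
  let B := br_alg eP hs in
  let P := br_proj eP hs in
  morita_equivalent B A /\
  (projective P /\
   exists (r : right_action A P)
     (fgP : forall N : lmodType B, fin_gen N -> fin_gen (hom_mod_of N r)),
     inverse_right_adjoint (br_functor eP hs) (homF fgP)) /\
  (forall (M : lmodType A) (v : 'I_n),
     is_ker_coker eP hs M v (br_el (qrs_vertex Q) (s := s)) (br_sec (qrs_vertex Q) (s := s)) /\
     (heads_unbroken s v ->
      is_ker_coker eP hs M v
        (fun i => st_el (st_at i)) (fun i => st_sec (st_at i)))).
Proof.
split; [|split; [split|]].
- exact: br_morita_equivalent.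
- exact: br_proj_projective.
- exact: br_inverse_right_adjoint.
- move=> M v; split; first exact: br_ker_coker.
  exact: unbroken_ker_coker.
Qed.
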